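(* Assume hypothesis (H). Then $$\sum_{N>0}\dim_{\mathbb Q}\ker C_{N,4}\, x^N\;\ge\; 3\,\mathbb O(x)^2\mathbb S(x)-\mathbb S(x)^2,$$ coefficientwise.
   Context: For integers $N,r\ge1$ let $S_{N,r}=\{(n_1,\dots,n_r)\in\mathbb Z^r:\ n_1+\dots+n_r=N,\ \text{each } n_i\ge3 \text{ odd}\}$; when used as an index set it is ordered lexicographically decreasingly. For $m=(m_1,\dots,m_r)$ and $n=(n_1,\dots,n_r)$ let $\delta\binom{m}{n}=1$ if $m_i=n_i$ for all $i$, and $0$ otherwise. $\mathbf V_{N,r}$ is the $\mathbb Q$-span of the monomials $x_1^{n_1-1}\cdots x_r^{n_r-1}$ with $(n_1,\dots,n_r)\in S_{N,r}$. $\mathsf{Vect}_{N,r}=\mathbb Q^{S_{N,r}}$ (row vectors), and $\pi:\mathbf V_{N,r}\to\mathsf{Vect}_{N,r}$ is the isomorphism sending $\sum a_{n_1,\dots,n_r}x_1^{n_1-1}\cdots x_r^{n_r-1}$ to $(a_{n_1,\dots,n_r})_{(n_1,\dots,n_r)\in S_{N,r}}$. For $r\ge2$, $\mathbf W_{N,r}=\{P\in\mathbf V_{N,r}: P(x_1,\dots,x_r)=P(x_2-x_1,x_2,x_3,\dots,x_r)-P(x_2-x_1,x_1,x_3,\dots,x_r)\}$. Ihara action: for $f\in\mathbb Q[t]$ and a polynomial $g$ in $r-1$ variables, $(f\mathbin{\underline\circ}g)(x_1,\dots,x_r)=f(x_1)g(x_2,\dots,x_r)+\sum_{i=1}^{r-1}\big(f(x_{i+1}-x_i)g(x_1,\dots,\widehat{x_{i+1}},\dots,x_r)-(-1)^{\deg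 f}f(x_i-x_{i+1})g(x_1,\dots,\widehat{x_i},\dots,x_r)\big)$ (hats denote omitted variables). For positive integers $m_i,n_i$, $e\binom{m_1,\dots,m_r}{n_1,\dots,n_r}$ is the coefficient of $x_1^{n_1-1}\cdots x_r^{n_r-1}$ in $t^{m_1-1}\mathbin{\underline\circ}\,(y_1^{m_2-1}\cdots y_{r-1}^{m_r-1})$. $E_{N,r}$ is the $S_{N,r}\times S_{N,r}$ matrix with $(m,n)$-entry $e\binom{m}{n}$. For $2\le j\le r$, $E^{(j)}_{N,r}$ is the $S_{N,r}\times S_{N,r}$ matrix with $(m,n)$-entry $\delta\binom{m_1,\dots,m_{r-j}}{n_1,\dots,n_{r-j}}\,e\binom{m_{r-j+1},\dots,m_r}{n_{r-j+1},\dots,n_r}$ (so $E^{(r)}_{N,r}=E_{N,r}$). $C_{N,r}=E^{(2)}_{N,r}E^{(3)}_{N,r}\cdots E^{(r-1)}_{N,r}E_{N,r}$ (so $C_{N,2}=E_{N,2}$), and $F_{N,r}=E_{N,r}-\mathrm{id}$. For a matrix $A$, $\ker A$ denotes its right kernel (column vectors $v$ with $Av=0$). $\mathbb O(x)=\frac{x^3}{1-x^2}$, $\mathbb S(x)=\frac{x^{12}}{(1-x^4)(1-x^6)}$. It is known (Tasaka) that for $r\ge2$ and $P\in\mathbf W_{N,r}$, $\pi(P)F_{N,r}$ lies in the left kernel $\{v: vE_{N,r}=0\}$. Hypothesis (H): for all $N$ and all $r\ge2$ the linear map $\mathbf W_{N,r}\to\{v\in\mathsf{Vect}_{N,r}: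 vE_{N,r}=0\}$, $P\mapsto\pi(P)F_{N,r}$, is injective. *)

(* Defs.v *)
From HB Require Import structures.
From mathcomp Require Import all_boot all_order all_algebra.
Set Implicit Arguments. Unset Strict Implicit. Unset Printing Implicit Defensive.
Import Order.TTheory GRing.Theory Num.Theory.
Local Open Scope ring_scope.

(* ---------- Multivariate polynomials over Q (variables x_0, x_1, ...) ----------
   A polynomial is a finite list of terms (c, e): c * prod_i x_i^(e_i)
   (exponent sequences are padded with zeros).  Equality of polynomials is
   equality of all coefficients. *)
Definition mterm := (rat * seq nat)%type.
Definition mpoly := seq mterm.

Definition expeq (s t : seq nat) : bool :=
  all (fun i => nth 0%N s i == nth 0%N t i) (iota 0 (maxn (size s) (size t))).
Definition mcoef (p : mpoly) (e : seq nat) : rat := \sum_(t <- p | expeq t.2 e) t.1.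
Definition meq (p q : mpoly) : Prop := forall e, mcoef p e = mcoef q e.

Definition madd (p q : mpoly) : mpoly := p ++ q.
Definition mscale (c : rat) (p : mpoly) : mpoly := [seq (c * t.1, t.2) | t <- p].
Definition msub (p q : mpoly) : mpoly := madd p (mscale (-1) q).
Definition expadd (s t : seq nat) : seq nat :=
  mkseq (fun i => (nth 0 s i + nth 0 t i)%N) (maxn (size s) (size t)).
Definition mmul (p q : mpoly) : mpoly := [seq (t.1 * u.1, expadd t.2 u.2) | t <- p, u <- q].
Definition mone : mpoly := [:: (1, [::])].
Definition mpow (p : mpoly) (k : nat) : mpoly := iter k (mmul p) mone.
Definition mvar (i : nat) : mpoly := [:: (1, rcons (nseq i 0%N) 1%N)].
Definition mmono (s : seq nat) : mpoly := [:: (1, s)].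
Definition msubst (sigma : nat -> mpoly) (p : mpoly) : mpoly :=
  flatten [seq mscale t.1 (foldr mmul mone
             [seq mpow (sigma i) (nth 0%N t.2 i) | i <- iota 0 (size t.2)]) | t <- p].
Definition upoly_at (f : {poly rat}) (L : mpoly) : mpoly :=
  flatten [seq mscale f`_k (mpow L k) | k <- iota 0 (size f)].

(* ---------- Ihara action (paper's x_1..x_r are our x_0..x_{r-1}) ---------- *)
Definition ihara (r : nat) (f : {poly rat}) (g : mpoly) : mpoly :=
  let d := (size f).-1 in
  madd (mmul (upoly_at f (mvar 0)) (msubst (fun j => mvar j.+1) g))
    (flatten [seq madd
        (mmul (upoly_at f (msub (mvar i.+1) (mvar i)))
              (msubst (fun j => mvar (bump i.+1 j)) g))
        (mscale (- (-1) ^+ d)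
           (mmul (upoly_at f (msub (mvar i) (mvar i.+1)))
                 (msubst (fun j => mvar (bump i j)) g)))
      | i <- iota 0 r.-1]).

Definition ecoef (m n : seq nat) : rat :=
  mcoef (ihara (size m) ('X^((head 0%N m).-1)) (mmono [seq k.-1 | k <- behead m]))
        [seq k.-1 | k <- n].

Fixpoint Sset (N r : nat) : seq (seq nat) :=
  match r with
  | 0 => if N == 0%N then [:: [::]] else [::]
  | r'.+1 => flatten [seq [seq n :: t | t <- Sset (N - n) r']
                     | n <- rev (iota 0 N.+1) & odd n && (3 <= n)%N]
  end.
Definition Sidx (N r : nat) : nat := size (Sset N r).
Definition Selt (N r : nat) (i : 'I_(Sidx N r)) : seq nat := nth [::] (Sset N r) i.

Definition Ej (N r j : nat) : 'M[rat]_(Sidx N r) :=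
  \matrix_(i, k) (if take (r - j) (Selt i) == take (r - j) (Selt k)
                  then ecoef (drop (r - j) (Selt i)) (drop (r - j) (Selt k)) else 0).
Definition Emx (N r : nat) : 'M[rat]_(Sidx N r) := Ej N r r.
Definition Cmx (N r : nat) : 'M[rat]_(Sidx N r) :=
  foldr (fun j A => Ej N r j *m A) 1%:M (iota 2 r.-1).
Definition Fmx (N r : nat) : 'M[rat]_(Sidx N r) := Emx N r - 1%:M.

(* dimension of the right kernel {v | A v = 0} *)
Definition dimker (n : nat) (A : 'M[rat]_n) : nat := \rank (kermx A^T).

(* ---------- W_{N,r} (via pi^{-1}) ---------- *)
Definition polyOf (N r : nat) (v : 'rV[rat]_(Sidx N r)) : mpoly :=
  [seq (v 0 i, [seq k.-1 | k <- Selt i]) | i <- enum 'I_(Sidx N r)].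
Definition sig1 (j : nat) : mpoly := if j == 0%N then msub (mvar 1) (mvar 0) else mvar j.
Definition sig2 (j : nat) : mpoly :=
  if j == 0%N then msub (mvar 1) (mvar 0) else if j == 1%N then mvar 0 else mvar j.
Definition inW (N r : nat) (v : 'rV[rat]_(Sidx N r)) : Prop :=
  meq (polyOf v) (msub (msubst sig1 (polyOf v)) (msubst sig2 (polyOf v))).

Definition hypH : Prop :=
  forall (N r : nat), (2 <= r)%N ->
  forall v w : 'rV[rat]_(Sidx N r), inW v -> inW w ->
    v *m Fmx N r = w *m Fmx N r -> v = w.

Definition series := nat -> rat.
Definition ps_mul (a b : series) : series := fun n => \sum_(k < n.+1) a k * b (n - k)%N.
Definition ps_X (k : nat) : series := fun n => (n == k)%:R.
(* 1/(1 - x^k) for k >= 1 *)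
Definition ps_geom (k : nat) : series := fun n => (k %| n)%:R.
Definition Oser : series := ps_mul (ps_X 3) (ps_geom 2).
Definition Sser : series := ps_mul (ps_X 12) (ps_mul (ps_geom 4) (ps_geom 6)).

(* Main.v *)
(* Let W be the space of even period polynomials in two variables.  The three
   subspaces W12, W23, W34 of V_{N,4}, where W is imposed on two consecutive
   variables, all lie in the left kernel of C = E^(2) E^(3) E^(4).  Indeed, for P
   in W_{N,r} a direct computation gives P F = - P E^(r-1), and P E^(r-1) E^(r) = 0
   because the Ihara action satisfies f1 o (f2 o g) - f2 o (f1 o g) = {f1, f2} o g
   while the brackets combine to 0 along a period polynomial.  By (H), E^(r-1) is
   then injective on W_{N,r}; this gives that W23 meets W12 + W34 trivially.  Hence
   dim ker C >= dim W23 + dim (W12 + W34), which is the claimed coefficient as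
   soon as dim W is at least the coefficient of S.  The latter holds since
   P |-> P(x,y) - P(y-x,y) + P(y-x,x) sends even antisymmetric polynomials of
   degree d to antisymmetric polynomials on the plane a + b + c = 0, which are
   determined by d %/ 6 of their coefficients. *)

Require Import Defs.
From HB Require Import structures.
From mathcomp Require Import all_boot all_order all_algebra.
From mathcomp Require Import ring lra zify.
Import GRing.Theory Num.Theory.
Local Open Scope ring_scope.
Set Implicit Arguments. Unset Strict Implicit. Unset Printing Implicit Defensive.

(** * Evaluation of polynomials *)

(** The estimate for dim W goes in one direction only, whereas the bound contains - S^2. Each weight
    K is therefore given a subspace of W whose dimension is exactly the coefficient of S, with a
    basis in echelon form: on a chosen set of pivot indices its members take the values 0 and 1
    only. The ranks are then bounded below by identity blocks. For W12 + W34 the block sits at the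
    indices whose first or last pair is a pivot, for W23 at those whose middle pair is one.
    Inclusion-exclusion counts the former as 2 O^2 S - S^2, and the latter contribute O^2 S. The
    supply of pivots in weight K = d + 2 is the integer quotient (d - 1) / 4, the number of even
    antisymmetric binomials of degree d with positive exponents, minus the d / 6 conditions that
    force the antisymmetrization to vanish. *)

Fixpoint mon (x : nat -> rat) (s : seq nat) : rat :=
  if s is a :: s' then x 0%N ^+ a * mon (x \o S) s' else 1.

Definition ev (x : nat -> rat) (p : mpoly) : rat := \sum_(t <- p) t.1 * mon x t.2.

Lemma mon_ext x y s : x =1 y -> mon x s = mon y s.
Proof.
elim: s x y => //= a s IH x y xy; rewrite xy; congr (_ * _).
by apply: IH => i /=; rewrite xy.
Qed.

Lemma mon_prod x s n : (size s <= n)%N ->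
  mon x s = \prod_(i < n) x i ^+ nth 0%N s i.
Proof.
elim: n x s => [|n IH] x [|a s] //= szs.
- by rewrite big_ord0.
- by rewrite big1 // => i _; rewrite nth_nil expr0.
- by rewrite big_ord_recl /= (IH _ s).
Qed.

Lemma mon_expadd x s t : mon x (expadd s t) = mon x s * mon x t.
Proof.
set n := maxn (size s) (size t).
rewrite !(@mon_prod x _ n) ?leq_maxl ?leq_maxr ?size_mkseq //.
rewrite -big_split /=; apply: eq_bigr => i _.
by rewrite nth_mkseq // exprD.
Qed.

Lemma ev_nil x : ev x [::] = 0. Proof. by rewrite /ev big_nil. Qed.

Lemma ev_add x p q : ev x (madd p q) = ev x p + ev x q.
Proof. by rewrite /ev big_cat. Qed.

Lemma ev_flatten x (ps : seq mpoly) : ev x (flatten ps) = \sum_(p <- ps) ev x p.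
Proof.
by elim: ps => [|p ps IH]; rewrite ?big_nil ?ev_nil // big_cons -IH -ev_add.
Qed.

Lemma ev_scale x c p : ev x (mscale c p) = c * ev x p.
Proof.
by rewrite /ev big_map mulr_sumr; apply: eq_bigr => t _; rewrite mulrA.
Qed.

Lemma ev_sub x p q : ev x (msub p q) = ev x p - ev x q.
Proof. by rewrite ev_add ev_scale mulN1r. Qed.

Lemma ev_mul x p q : ev x (mmul p q) = ev x p * ev x q.
Proof.
rewrite /ev big_allpairs_dep mulr_suml; apply: eq_bigr => t _.
rewrite mulr_sumr; apply: eq_bigr => u _ /=.
by rewrite mon_expadd; ring.
Qed.

Lemma ev_one x : ev x mone = 1.
Proof. by rewrite /ev big_seq1 mulr1. Qed.

Lemma ev_pow x p k : ev x (mpow p k) = ev x p ^+ k.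
Proof. by elim: k => [|k IH]; rewrite ?ev_one // ev_mul IH exprS. Qed.

Lemma ev_mono x s : ev x (mmono s) = mon x s.
Proof. by rewrite /ev big_seq1 mul1r. Qed.

Lemma ev_var x i : ev x (mvar i) = x i.
Proof.
rewrite /ev big_seq1 mul1r /=.
by elim: i x => [|i IH] x /=; rewrite ?expr1 ?mulr1 // expr0 mul1r IH.
Qed.

Lemma ev_subst x sigma p : ev x (msubst sigma p) = ev (fun i => ev x (sigma i)) p.
Proof.
rewrite ev_flatten big_map; apply: eq_bigr => t _.
rewrite ev_scale (@mon_prod _ _ (size t.2)) //; congr (_ * _).
rewrite -(big_mkord xpredT (fun i => ev x (sigma i) ^+ nth 0%N t.2 i)).
rewrite /index_iota subn0; elim: (iota _ _) => [|i s IH] /=.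
  by rewrite big_nil ev_one.
by rewrite big_cons ev_mul ev_pow IH.
Qed.

Lemma ev_upoly x f L : ev x (upoly_at f L) = f.[ev x L].
Proof.
rewrite ev_flatten big_map horner_coef.
rewrite -(big_mkord xpredT (fun i => f`_i * ev x L ^+ i)) /index_iota subn0.
by apply: eq_bigr => k _; rewrite ev_scale ev_pow.
Qed.

Lemma horner_eq0 (p : {poly rat}) : (forall a, p.[a] = 0) -> p = 0.
Proof.
move=> p0; apply: (@roots_geq_poly_eq0 _ p [seq i%:R | i <- iota 0 (size p)]).
- by apply/allP => a _; rewrite rootE p0.
- rewrite map_inj_uniq ?iota_uniq // => i j /eqP.
  by rewrite eqr_nat => /eqP.
- by rewrite size_map size_iota.
Qed.

(* Polynomials are compared by evaluation on Q^nat: this turns every identity between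
   them into an identity between rational functions of points. *)
Lemma ev_eq0_coef n p : all (fun t : mterm => size t.2 == n) p ->
  (forall x, ev x p = 0) -> forall e, \sum_(t <- p | t.2 == e) t.1 = 0.
Proof.
elim: n p => [|n IH] p /allP szp p0 e.
  have [e0|ne0] := eqVneq e [::]; last first.
    rewrite big_seq_cond big_pred0 // => t; apply/negP => /andP[/szp/nilP-> /eqP te].
    by rewrite -te eqxx in ne0.
  rewrite -[RHS](p0 (fun=> 0)) /ev e0 [LHS]big_seq_cond [RHS]big_seq_cond.
  apply: eq_big => [t|t /andP[/szp/nilP-> _]]; last by rewrite mulr1.
  by have [/szp/nilP->|] := boolP (t \in p).
case: e => [|k e].
  by rewrite big_seq_cond big_pred0 // => t; apply/negP => /andP[/szp + /eqP te]; rewrite te.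
have szS (t : mterm) : t \in p -> t.2 = head 0%N t.2 :: behead t.2.
  by move=> /szp; case: t.2.
pose pk := [seq (t.1, behead t.2) | t <- p & head 0%N t.2 == k].
have: \sum_(t <- pk | t.2 == e) t.1 = 0.
  apply: IH => [|x].
    apply/allP => t /mapP[u]; rewrite mem_filter => /andP[_ /szp/eqP + ->] /=.
    by rewrite size_behead => ->.
  (* Freezing all variables but the first turns p into a univariate polynomial that vanishes
     everywhere; its coefficient of degree k is [ev x pk]. *)
  pose P := \sum_(t <- p) (t.1 * mon x (behead t.2)) *: 'X^(head 0%N t.2).
  have: P = 0.
    apply: horner_eq0 => a; rewrite -(p0 (fun i => if i is j.+1 then x j else a)).
    rewrite horner_sum /ev [LHS]big_seq [RHS]big_seq; apply: eq_bigr => t /szS tE.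
    rewrite hornerZ hornerXn [in RHS]tE /= mulrAC -mulrA; congr (_ * (_ * _)).
  move=> /(congr1 (fun q : {poly rat} => q`_k)); rewrite coef0 coef_sum => sk0.
  rewrite -[RHS]sk0.
  rewrite /ev big_map big_filter big_mkcond; apply: eq_bigr => t _ /=.
  rewrite coefZ coefXn [k == _]eq_sym.
  by case: eqP => _; rewrite ?mulr1 ?mulr0.
move=> sk0; rewrite -[RHS]sk0 big_map big_filter_cond.
rewrite big_seq_cond [RHS]big_seq_cond; apply: eq_bigl => t /=.
by have [/szS->|] := boolP (t \in p).
Qed.

Lemma ev_meq p q : (forall x, ev x p = ev x q) -> meq p q.
Proof.
move=> pq e; apply/eqP; rewrite -subr_eq0; apply/eqP.
pose n := maxn (size e) (\max_(t <- p ++ q) size t.2).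
(* [expeq] ignores trailing zeros; once all exponents are padded to a common length it is plain
   equality, as [ev_eq0_coef] requires. *)
pose pad (s : seq nat) := mkseq (nth 0%N s) n.
have padE (s : seq nat) : (size s <= n)%N -> expeq s e = (pad s == pad e).
  move=> szs; apply/allP/eqP => [se|se i _].
    apply: (@eq_from_nth _ 0%N); rewrite ?size_mkseq // => i ltin.
    rewrite !nth_mkseq //.
    have [lti|gei] := ltnP i (maxn (size s) (size e)).
      by apply/eqP/se; rewrite mem_iota.
    by rewrite geq_max in gei; case/andP: gei => ? ?; rewrite !nth_default.
  have [ltin|lein] := ltnP i n.
    by have := congr1 (nth 0%N ^~ i) se; rewrite !nth_mkseq // => ->.
  by rewrite !nth_default // (leq_trans _ lein) // leq_maxl.
have szn (t : mterm) : t \in p ++ q -> (size t.2 <= n)%N.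
  by move=> tpq; rewrite leq_max (@leq_bigmax_seq mterm _ xpredT (fun u => size u.2)) ?orbT.
pose pq' : mpoly := [seq (t.1, pad t.2) | t <- p ++ mscale (-1) q].
have szpq (t : mterm) : t \in p ++ mscale (-1) q -> (size t.2 <= n)%N.
  rewrite mem_cat => /orP[tp|/mapP[u uq ->]] /=; apply: szn; rewrite mem_cat ?tp ?uq ?orbT //.
have: \sum_(t <- pq' | t.2 == pad e) t.1 = 0.
  apply: (@ev_eq0_coef n) => [|x].
    by apply/allP => t /mapP[u _ ->]; rewrite size_mkseq.
  rewrite -[RHS](subrr (ev x p)) [X in _ = _ - X]pq -ev_sub.
  rewrite /ev big_map [LHS]big_seq [RHS]big_seq; apply: eq_bigr => t tpq /=.
  rewrite !(@mon_prod x _ n) ?size_mkseq ?szpq //.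
  by congr (_ * _); apply: eq_bigr => i _; rewrite nth_mkseq.
move=> s0; rewrite -[RHS]s0 big_map big_cat big_map /= /mcoef -sumrN.
congr (_ + _); rewrite big_seq_cond [RHS]big_seq_cond.
  apply: eq_bigl => t /=; have [tp|] := boolP (t \in p) => //=.
  by rewrite padE ?szn // mem_cat tp.
apply: eq_big => [t|t _] /=; last by rewrite mulN1r.
have [tp|] := boolP (t \in q) => //=.
by rewrite padE ?szn // mem_cat tp orbT.
Qed.

(** * Explicit terms of the Ihara action *)

Lemma sum_iota n (F : nat -> rat) : \sum_(k <- iota 0 n) F k = \sum_(k < n) F k.
Proof. by rewrite -(big_mkord xpredT) /index_iota subn0. Qed.

(** Coefficient of x_0^k x_1^(a-k) in (x_1 - x_0)^a. *)
Definition cbin (a k : nat) : rat := (-1) ^+ k *+ 'C(a, k).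

Fixpoint ihara_tail (a : nat) (s : seq nat) : mpoly :=
  if s is b :: s' then
    flatten [seq [:: (cbin a k, [:: b + k, a - k & s']%N);
                     (- cbin a k, [:: k, b + (a - k) & s']%N)] | k <- iota 0 a.+1]
    ++ [seq (t.1, b :: t.2) | t <- ihara_tail a s']
  else [::].

(* For [a] even, [ihara_terms a s] lists the monomials of t^a o y^s; all exponent
   sequences have length [(size s).+1].  The head term is f(x_1) g(x_2, ..., x_r), and
   [ihara_tail] collects the differences over the edges (x_i, x_{i+1}). *)
Definition ihara_terms (a : nat) (s : seq nat) : mpoly := (1, a :: s) :: ihara_tail a s.

Lemma ev_ihara_tail_cons x a b s : ev x (ihara_tail a (b :: s)) =
  (x 1%N - x 0%N) ^+ a * (x 0%N ^+ b - x 1%N ^+ b) * mon (x \o S \o S) s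
  + x 0%N ^+ b * ev (x \o S) (ihara_tail a s).
Proof.
rewrite {1}/ihara_tail -/ihara_tail -[_ ++ _]/(madd _ _) ev_add; congr (_ + _); last first.
  by rewrite /ev big_map mulr_sumr; apply: eq_bigr => t _ /=; ring.
rewrite exprBn ev_flatten big_map !mulr_suml.
rewrite sum_iota; apply: eq_bigr => k _.
rewrite /ev !big_cons big_nil /= addr0 /cbin !exprD.
by rewrite -[_ *+ _]mulr_natr -[X in _ = X * _ * _]mulr_natr; ring.
Qed.

Lemma ev_ihara_tail x a s : ev x (ihara_tail a s) =
  \sum_(i < size s) (x i.+1 - x i) ^+ a * (mon (x \o bump i.+1) s - mon (x \o bump i) s).
Proof.
elim: s x => [|b s IH] x; first by rewrite ev_nil big_ord0.
rewrite ev_ihara_tail_cons IH big_ord_recl /=; congr (_ + _).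
  rewrite !(@mon_ext (_ \o S) (x \o S \o S)) //.
  by rewrite /bump /= -mulrA -mulrBl.
rewrite mulr_sumr; apply: eq_bigr => i _ /=; rewrite mulrCA; congr (_ * _).
rewrite mulrBr; congr (_ * _ - _ * _); apply: mon_ext => j /=; congr x.
  by rewrite /bump /= add1n ltnS addnS.
by rewrite /bump /= add1n ltnS addnS.
Qed.

Lemma ev_ihara_terms x a s : ev x (ihara_terms a s) = x 0%N ^+ a * mon (x \o S) s + ev x (ihara_tail a s).
Proof. by rewrite {1}/ev big_cons mul1r. Qed.

(** In even degree the sign -(-1)^deg is -1 and f(x_i - x_{i+1}) = f(x_{i+1} - x_i), so the two
    terms of an edge share one factor. *)
Lemma ev_ihara x r a s : ~~ odd a -> size s = r.-1 ->
  ev x (ihara r 'X^a (mmono s)) = ev x (ihara_terms a s).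
Proof.
move=> ea szs; rewrite ev_ihara_terms ev_add; congr (_ + _).
  rewrite ev_mul ev_upoly hornerXn ev_var ev_subst ev_mono; congr (_ * _).
  by apply: mon_ext => i; rewrite ev_var.
rewrite ev_ihara_tail ev_flatten big_map -szs sum_iota.
apply: eq_bigr => i _.
rewrite ev_add ev_scale !ev_mul !ev_upoly !hornerXn !ev_sub !ev_var !ev_subst !ev_mono.
rewrite size_polyXn -signr_odd (negPf ea) expr0 mulN1r.
rewrite -[x i - x i.+1]opprB exprNn -signr_odd (negPf ea) mul1r.
rewrite -mulrBr; congr (_ * (_ - _)); apply: mon_ext => j; exact: ev_var.
Qed.

Definition scoef (p : mpoly) (e : seq nat) : rat := \sum_(t <- p | t.2 == e) t.1.

Lemma expeq_size s t : size s = size t -> expeq s t = (s == t).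
Proof.
move=> st; apply/allP/eqP => [e|-> //].
apply: (eq_from_nth (x0 := 0%N)) => // i lti; apply/eqP/e.
by rewrite mem_iota -st maxnn.
Qed.

Lemma mcoef_scoef p e : all (fun t : mterm => size t.2 == size e) p -> mcoef p e = scoef p e.
Proof.
move=> /allP szp; rewrite /mcoef /scoef big_seq_cond [RHS]big_seq_cond.
apply: eq_bigl => t; have [/szp/eqP tp|] := boolP (t \in p) => //=.
exact: expeq_size.
Qed.

Lemma size_ihara_tail a s : all (fun t : mterm => size t.2 == (size s).+1) (ihara_tail a s).
Proof.
elim: s => [//|b s IH]; apply/allP => t; rewrite {1}/ihara_tail -/ihara_tail mem_cat => /orP[/flattenP|/mapP].
  by case=> l /mapP[k _ ->]; rewrite !inE => /orP[] /eqP -> /=.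
case=> u util -> /=; rewrite eqSS; exact: (allP IH).
Qed.

Lemma size_ihara_terms a s : all (fun t : mterm => size t.2 == (size s).+1) (ihara_terms a s).
Proof. by rewrite /= size_ihara_tail eqxx. Qed.

Lemma ecoefE a m n : odd a -> size n = (size m).+1 ->
  ecoef (a :: m) n = scoef (ihara_terms a.-1 (map predn m)) (map predn n).
Proof.
move=> oa szn; rewrite /ecoef /=.
rewrite -mcoef_scoef ?size_map ?szn -1?(size_map predn m) ?size_ihara_terms //.
apply: ev_meq => x; rewrite ev_ihara ?size_map //.
by case: a oa.
Qed.

(** Coefficient of x_0^u x_1^v in (x_1 - x_0)^a (x_0^b - x_1^b), the contribution of the first
    edge. *)
Definition Bc (a b u v : nat) : rat :=
  \sum_(k < a.+1) (cbin a k *+ ((b + k == u) && (a - k == v))%N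
                   - cbin a k *+ ((k == u :> nat) && (b + (a - k) == v))%N).

Lemma scoef_ihara_tail_cons a b s u v e : scoef (ihara_tail a (b :: s)) [:: u, v & e] =
  Bc a b u v *+ (s == e) + scoef (ihara_tail a s) (v :: e) *+ (b == u).
Proof.
rewrite /scoef {1}/ihara_tail -/ihara_tail big_cat big_map; congr (_ + _); last first.
  rewrite -sumrMnl big_mkcond [RHS]big_mkcond; apply: eq_bigr => t _.
  by rewrite /= eqseq_cons andbC; case: (_ == _ :: _); case: eqP; rewrite //= ?mul0rn.
rewrite big_flatten big_map sum_iota /Bc -sumrMnl.
apply: eq_bigr => k _; rewrite !big_cons big_nil /= !eqseq_cons.
rewrite !andbA; case: (s == e); rewrite ?andbT ?andbF ?mulr0n // mulr1n addr0.
by do 2!case: ifP => _; rewrite ?mulr1n ?mulr0n ?addr0 ?subr0 ?sub0r.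
Qed.

Lemma Bc_neq0 a b u v : Bc a b u v != 0 -> b != 0%N /\ (a + b = u + v)%N.
Proof.
move=> nz; have [b0|nb] := eqVneq b 0%N.
  case/eqP: nz; rewrite b0 /Bc big1 // => k _.
  by rewrite !add0n subrr.
split=> //; apply: contraNeq nz => ne; rewrite /Bc big1 // => k _.
have := ltn_ord k; rewrite ltnS => lek.
do 2?case: andP => [[/eqP ? /eqP ?]|_]; try lia.
by rewrite subrr.
Qed.

Definition even_gt0 k := (0 < k)%N && ~~ odd k.

(* One Ihara step changes at most one exponent of [s], so by parity of the total degree a
   totally even monomial can only come from a totally even one; an exponent 0 cancels
   in the difference. *)
Lemma ihara_tail_support a s e : ~~ odd a -> all even_gt0 e -> size e = (size s).+1 ->
  scoef (ihara_tail a s) e != 0 -> all even_gt0 s /\ (a + sumn s = sumn e)%N.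
Proof.
move=> ea; elim: s e => [|b s IH] [|u [|v e]] //=.
  by rewrite /scoef big_nil eqxx.
move=> /and3P[eu ev ee] [sz]; rewrite -/(ihara_tail a (b :: s)) scoef_ihara_tail_cons.
have [eE|ne] := eqVneq s e.
  subst e.
  have [b0|nb] := eqVneq (Bc a b u v) 0; last first.
    move=> _; have [b0 abuv] := Bc_neq0 nb; split; last lia.
    apply/andP; split=> //; move: eu ev => /andP[_ eu] /andP[_ ev]; rewrite /even_gt0 lt0n b0 /=.
    by have := congr1 odd abuv; rewrite !oddD (negPf ea) (negPf eu) (negPf ev) /= => ->.
  rewrite b0 mul0rn add0r; case: (b =P u) => [->|_]; rewrite ?mulr0n ?eqxx // => nz.
  have /(_ (v :: s)) := IH; rewrite /= ev ee => /(_ isT erefl nz) [_ sE].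
  by split; [rewrite eu | lia].
rewrite mulr0n add0r; case: (b =P u) => [->|_]; rewrite ?mulr0n ?eqxx // => nz.
have /(_ (v :: e)) := IH; rewrite /= ev ee sz => /(_ isT erefl nz) [-> sE].
by split; rewrite ?andbT //; lia.
Qed.

Lemma ihara_terms_support a s e : ~~ odd a -> all even_gt0 e -> size e = (size s).+1 ->
  scoef (ihara_terms a s) e != 0 -> all even_gt0 s /\ (a + sumn s = sumn e)%N.
Proof.
move=> ea eve sz; rewrite /scoef big_cons /=; case: (a :: s =P e) => [eE|_]; last exact: (ihara_tail_support ea eve sz).
by move: eve; rewrite -eE /= => /andP[].
Qed.

(** * The index sets and the matrices E^(j) *)

Definition odd_ge3 k := odd k && (3 <= k)%N.

Lemma SsetE N r : Sset N r.+1 =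
  flatten [seq [seq n :: t | t <- Sset (N - n) r] | n <- rev (iota 0 N.+1) & odd_ge3 n].
Proof. by []. Qed.

Lemma mem_Sset N r m :
  (m \in Sset N r) = [&& size m == r, sumn m == N & all odd_ge3 m].
Proof.
elim: r N m => [|r IH] N m.
  rewrite /=; case: m => [|a m] /=; last by case: ifP.
  by rewrite andbT eq_sym; case: ifP.
rewrite SsetE; apply/flattenP/idP => [[l /mapP[a]]|].
  rewrite mem_filter mem_rev mem_iota add0n ltnS => /andP[oka leaN] -> /mapP[t].
  rewrite IH => /and3P[/eqP szt /eqP st okt] -> /=.
  by rewrite szt eqxx st subnKC // eqxx okt andbT.
case: m => [|a m]; first by [].
move=> /and3P[szm /eqP sm]; rewrite [all _ _]/= => /andP[oka okm]; rewrite /= in sm.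
exists [seq a :: t | t <- Sset (N - a) r].
  apply/mapP; exists a => //; rewrite mem_filter mem_rev mem_iota.
  by rewrite oka add0n ltnS -sm leq_addr.
by apply/mapP; exists m => //; rewrite IH -eqSS szm okm -sm addKn eqxx.
Qed.

Lemma Sset_uniq N r : uniq (Sset N r).
Proof.
elim: r N => [|r IH] N; first by rewrite /=; case: ifP.
rewrite SsetE; have: uniq [seq n <- rev (iota 0 N.+1) | odd_ge3 n].
  by rewrite filter_uniq // rev_uniq iota_uniq.
elim: [seq _ <- _ | _] => //= a s IHs /andP[as_ us].
rewrite cat_uniq IHs // andbT map_inj_uniq ?IH; last by move=> ? ? [].
apply/hasPn => m /flattenP[l /mapP[b bs ->]] /mapP[t _ ->].
by apply/mapP => -[t' _ [ab _]]; rewrite -ab bs in as_.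
Qed.

Lemma SsetS N r m : m \in Sset N r.+1 ->
  exists a t, [/\ m = a :: t, odd_ge3 a, (a <= N)%N & t \in Sset (N - a) r].
Proof.
rewrite mem_Sset; case: m => //= a t /and3P[szt /eqP st /andP[oka okt]].
by exists a, t; split=> //; rewrite ?mem_Sset -?st ?leq_addr // addKn -eqSS szt eqxx.
Qed.

Lemma odd_ge3_pred m : all odd_ge3 m -> all even_gt0 (map predn m).
Proof.
move=> /allP okm; apply/allP => k /mapP[a /okm /andP[oa lea] ->].
by case: a oa lea => [|a] //=; rewrite /even_gt0 ltnS => -> /ltnW ->.
Qed.

Lemma map_pred_inj m n : all odd_ge3 m -> all odd_ge3 n -> (map predn m == map predn n) = (m == n).
Proof.
elim: m n => [|a m IH] [|b n] //= /andP[oka okm] /andP[okb okn].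
rewrite !eqseq_cons IH //; congr (_ && _).
by case: a b oka okb => [|a] [|b].
Qed.

(** K is the weight of the first p entries. For p = 2 this isolates a fixed tail, so that a relation
    in the first two variables applies; it also turns counts of indices into products of series. *)
Lemma big_Sset_cat N p r (F : seq nat -> rat) :
  \sum_(m <- Sset N (p + r)) F m =
  \sum_(K < N.+1) \sum_(q <- Sset K p) \sum_(t <- Sset (N - K) r) F (q ++ t).
Proof.
transitivity (\sum_(K < N.+1) \sum_(m <- Sset N (p + r) | sumn (take p m) == K) F m).
  rewrite (exchange_big_dep xpredT) //= [LHS]big_seq [RHS]big_seq.
  apply: eq_bigr => m; rewrite mem_Sset => /and3P[_ /eqP sm _].
  have ltm : (sumn (take p m) < N.+1)%N.
    by rewrite ltnS -sm -{2}(cat_take_drop p m) sumn_cat leq_addr.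
  by rewrite (big_pred1 (Ordinal ltm)) // => K; rewrite /= eq_sym.
apply: eq_bigr => -[K /= ltK] _; rewrite ltnS in ltK.
rewrite -big_filter /=.
transitivity (\sum_(m <- [seq q ++ t | q <- Sset K p, t <- Sset (N - K) r]) F m); last first.
  by rewrite big_allpairs_dep.
apply: perm_big; apply: uniq_perm.
- by rewrite filter_uniq ?Sset_uniq.
- apply: allpairs_uniq; rewrite ?Sset_uniq // => -[q t] [q' t'].
  move=> /allpairsP[[? ?] /= [qS _ [? ?]]] /allpairsP[[? ?] /= [q'S _ [? ?]]]; subst=> /eqP.
  move: qS q'S; rewrite !mem_Sset => /andP[/eqP qS _] /andP[/eqP q'S _].
  by rewrite eqseq_cat ?qS ?q'S // => /andP[/eqP-> /eqP->].
move=> m; rewrite mem_filter mem_Sset; apply/idP/allpairsP => /=.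
  move=> /and4P[/eqP sK /eqP szm /eqP sm]; rewrite -{1}(cat_take_drop p m) all_cat.
  move=> /andP[okt okd]; exists (take p m, drop p m); rewrite /= !mem_Sset okt okd.
  have sd : (sumn (drop p m) = N - K)%N.
    by rewrite -sm -(cat_take_drop p m) sumn_cat sK cat_take_drop addKn.
  rewrite sK sd !eqxx size_takel ?szm ?leq_addr // size_drop szm addKn !eqxx.
  by rewrite cat_take_drop.
case=> -[q t] /= []; rewrite !mem_Sset.
move=> /and3P[/eqP szq /eqP sq okq] /and3P[/eqP szt /eqP st okt] ->.
by rewrite -szq take_size_cat // size_cat szt sumn_cat sq st subnKC // all_cat okq okt !eqxx.
Qed.

Lemma big_Sset_reindex N r (g : seq nat -> seq nat) (F : seq nat -> rat) :
  {in Sset N r, forall m, g m \in Sset N r} -> {in Sset N r &, injective g} ->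
  \sum_(m <- Sset N r) F (g m) = \sum_(m <- Sset N r) F m.
Proof.
move=> gS gI; rewrite -(big_map g xpredT F); apply: perm_big.
have ug : uniq (map g (Sset N r)) by rewrite map_inj_in_uniq ?Sset_uniq.
apply: uniq_perm; rewrite ?Sset_uniq //.
have sub : {subset map g (Sset N r) <= Sset N r} by move=> _ /mapP[m mS ->]; apply: gS.
by have [] := uniq_min_size ug sub; rewrite ?size_map.
Qed.

Lemma Selt_mem N r (i : 'I_(Sidx N r)) : Selt i \in Sset N r.
Proof. exact: mem_nth. Qed.

Lemma Selt_inj N r : injective (@Selt N r).
Proof.
move=> i j /eqP; rewrite /Selt nth_uniq ?Sset_uniq ?ltn_ord //.
by move=> /eqP ?; apply: val_inj.
Qed.

Lemma Selt_surj N r m : m \in Sset N r -> exists i : 'I_(Sidx N r), Selt i = m.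
Proof.
move=> mS; have ltm : (index m (Sset N r) < Sidx N r)%N by rewrite index_mem.
by exists (Ordinal ltm); rewrite /Selt nth_index.
Qed.

Lemma sum_Selt N r (F : seq nat -> rat) :
  \sum_(i < Sidx N r) F (Selt i) = \sum_(m <- Sset N r) F m.
Proof. by rewrite (big_nth [::]) big_mkord. Qed.

Definition mkrow N r (f : seq nat -> rat) : 'rV[rat]_(Sidx N r) := \row_i f (Selt i).

Lemma mkrowP N r f g :
  mkrow N r f = mkrow N r g <-> {in Sset N r, f =1 g}.
Proof.
split=> [/rowP fg m /Selt_surj[i <-]|fg]; first by have := fg i; rewrite !mxE.
by apply/rowP => i; rewrite !mxE fg ?Selt_mem.
Qed.

(* Row vectors are handled as functions on index sequences, the weight being read off
   the argument: [actE r j f] is the row vector [f] times E^(j)_{N,r}. *)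
Definition actE (r j : nat) (f : seq nat -> rat) (n : seq nat) : rat :=
  \sum_(m <- Sset (sumn n) r)
    f m * (if take (r - j) m == take (r - j) n
           then ecoef (drop (r - j) m) (drop (r - j) n) else 0).

Lemma sumn_Sset N r m : m \in Sset N r -> sumn m = N.
Proof. by rewrite mem_Sset => /and3P[_ /eqP]. Qed.

Lemma size_Sset N r m : m \in Sset N r -> size m = r.
Proof. by rewrite mem_Sset => /and3P[/eqP]. Qed.

Lemma mkrow_mulE N r j f : mkrow N r f *m Ej N r j = mkrow N r (actE r j f).
Proof.
apply/rowP => k; rewrite !mxE /actE (sumn_Sset (Selt_mem k)) -sum_Selt.
by apply: eq_bigr => i _; rewrite !mxE.
Qed.

Lemma big_Sset_head N r a (F : seq nat -> rat) : odd_ge3 a -> (a <= N)%N ->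
  \sum_(m <- Sset N r.+1 | head 0%N m == a) F m = \sum_(t <- Sset (N - a) r) F (a :: t).
Proof.
move=> oka leaN; rewrite -big_filter -[RHS](big_map (cons a) xpredT F).
apply: perm_big; apply: uniq_perm; first by rewrite filter_uniq ?Sset_uniq.
  by rewrite map_inj_uniq ?Sset_uniq // => ? ? [].
move=> m; rewrite mem_filter; apply/andP/mapP.
  by move=> [/eqP <- /SsetS[b [t [-> _ _ tS]]]]; exists t.
move=> [t tS ->]; split; first exact/eqP.
move: tS; rewrite !mem_Sset => /and3P[/eqP szt /eqP st okt].
by rewrite /= szt st okt subnKC // oka !eqxx.
Qed.

(** For j at most r the first index is among those that E^(j) keeps, so the matrix is block diagonal
    along it. *)
Lemma actE_cons r j f a n : odd_ge3 a -> (j <= r)%N ->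
  actE r.+1 j f (a :: n) = actE r j (fun m => f (a :: m)) n.
Proof.
move=> oka lejr; rewrite /actE /= subSn //.
transitivity (\sum_(m <- Sset (a + sumn n) r.+1 | head 0%N m == a)
   f m * (if take (r - j) (behead m) == take (r - j) n
           then ecoef (drop (r - j) (behead m)) (drop (r - j) n) else 0)).
  rewrite [RHS]big_mkcond [LHS]big_seq [RHS]big_seq; apply: eq_bigr => m /SsetS[b [t [-> _ _ _]]] /=.
  by rewrite eqseq_cons; case: eqP => //= _; rewrite mulr0.
by rewrite big_Sset_head ?leq_addr // addKn.
Qed.

(** * Period relations and the matrix F *)

Lemma scoef_flatten (ps : seq mpoly) e : scoef (flatten ps) e = \sum_(p <- ps) scoef p e.
Proof. by rewrite /scoef big_flatten. Qed.

Lemma scoef_scale c p e : scoef (mscale c p) e = c * scoef p e.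
Proof. by rewrite /scoef big_map mulr_sumr. Qed.

Lemma scoef_ihara_terms a s e : scoef (ihara_terms a s) e = (a :: s == e)%:R + scoef (ihara_tail a s) e.
Proof. by rewrite /scoef big_cons /=; case: (_ :: _ == _); rewrite ?add0r. Qed.

Lemma scoef_ev0 n p : all (fun t : mterm => size t.2 == n) p ->
  (forall x, ev x p = 0) -> forall e, scoef p e = 0.
Proof. exact: ev_eq0_coef. Qed.

Definition e0 (q : seq nat) := (nth 0%N q 0).-1.
Definition e1 (q : seq nat) := (nth 0%N q 1).-1.

Definition kap (q : seq nat) (x y : rat) : rat :=
  x ^+ e0 q * y ^+ e1 q - ((y - x) ^+ e0 q * y ^+ e1 q - (y - x) ^+ e0 q * x ^+ e1 q).

(* [w], restricted to weight [K], is the coefficient family of a polynomial in W_{K,2}. *)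
Definition Wc (K : nat) (w : seq nat -> rat) : Prop :=
  (forall a b, odd_ge3 a -> odd_ge3 b -> w [:: a; b] = - w [:: b; a])
  /\ (forall x y, \sum_(q <- Sset K 2) w q * kap q x y = 0).

Definition wcond (f : seq nat -> rat) : Prop := forall K t, Wc K (fun q => f (q ++ t)).

Lemma Sset2 K q : q \in Sset K 2 -> exists a b, [/\ q = [:: a; b], odd_ge3 a & odd_ge3 b].
Proof.
move=> /SsetS[a [t [-> oka _ /SsetS[b [s [-> okb _ +]]]]]].
by case: s => [|c s] /=; case: ifP => //; exists a, b.
Qed.

(** [kap q x y] equals x^e0 y^e1 + (y - x)^e0 (x^e1 - y^e1), which is the Ihara action of t^e0 on
    y^e1. The period relation thus says that these actions, weighted by w, sum to 0, and
    coefficients can be compared. *)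
Lemma Wc_coef K w u v : Wc K w ->
  \sum_(q <- Sset K 2) w q * (([:: e0 q; e1 q] == [:: u; v])%:R + Bc (e0 q) (e1 q) u v) = 0.
Proof.
move=> [_ w0].
rewrite -[RHS](@scoef_ev0 2 (flatten [seq mscale (w q) (ihara_terms (e0 q) [:: e1 q]) | q <- Sset K 2])
  _ _ [:: u; v]); first last.
- move=> x; rewrite ev_flatten big_map -[RHS](w0 (x 0%N) (x 1%N)); apply: eq_bigr => q _.
  rewrite ev_scale ev_ihara_terms ev_ihara_tail_cons ev_nil /= /kap; ring.
- apply/allP => t /flattenP[l /mapP[q _ ->]] /mapP[t' + ->] /=.
  exact: (allP (size_ihara_terms _ _)).
rewrite scoef_flatten big_map; apply: eq_bigr => q _.
rewrite scoef_scale scoef_ihara_terms scoef_ihara_tail_cons /scoef big_nil mul0rn addr0.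
by rewrite mulr1n.
Qed.

Lemma ev_polyOf N r f x :
  ev x (polyOf (mkrow N r f)) = \sum_(m <- Sset N r) f m * mon x (map predn m).
Proof.
rewrite /ev /polyOf big_map big_enum /= -sum_Selt.
by apply: eq_bigr => i _; rewrite mxE.
Qed.

Lemma wcond_inW N r f : wcond f -> inW (mkrow N r.+2 f).
Proof.
move=> fW; apply: ev_meq => x; rewrite ev_sub !ev_subst !ev_polyOf.
apply/eqP; rewrite -subr_eq0; apply/eqP.
rewrite -!sumrB (@big_Sset_cat N 2 r) big1 // => K _; rewrite exchange_big big1 //= => t _.
rewrite -[RHS](mulr0 (mon (x \o S \o S) (map predn t))) -{2}((fW K t).2 (x 0%N) (x 1%N)).
rewrite mulr_sumr big_seq [RHS]big_seq; apply: eq_bigr => q /Sset2[a [b [-> _ _]]].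
rewrite /kap /e0 /e1 /= !ev_sub !ev_var.
rewrite (@mon_ext ((fun i => ev x (sig1 i)) \o S \o S) (x \o S \o S)); last first.
  by move=> i; rewrite /= ev_var.
by ring.
Qed.

Definition swap01 (m : seq nat) : seq nat := if m is a :: b :: t then b :: a :: t else m.

Lemma SsetSS N r m : m \in Sset N r.+2 -> exists a b t,
  [/\ m = [:: a, b & t], odd_ge3 a, odd_ge3 b, (a + b <= N)%N & t \in Sset (N - (a + b)) r].
Proof.
move=> /SsetS[a [t [-> oka leaN /SsetS[b [s [-> okb lebN sS]]]]]].
by exists a, b, s; split=> //; [rewrite -leq_subRL | rewrite subnDA].
Qed.

Lemma big_Sset_swap N r (F : seq nat -> rat) :
  \sum_(m <- Sset N r) F (swap01 m) = \sum_(m <- Sset N r) F m.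
Proof.
have swapK : involutive swap01 by case=> [|a [|b t]].
apply: big_Sset_reindex => [m|]; last exact: in2W (can_inj swapK).
rewrite !mem_Sset; case: m => [|a [|b t]] //=.
by rewrite addnCA [odd_ge3 a && (_ && _)]andbCA.
Qed.

Lemma wcond_anti f a b t : wcond f -> odd_ge3 a -> odd_ge3 b ->
  f [:: a, b & t] = - f [:: b, a & t].
Proof. by move=> /(_ 0%N t) [fa _]; exact: fa. Qed.

Definition ecoef_tail (a : nat) (s n : seq nat) := scoef (ihara_tail a.-1 (map predn s)) (map predn n).

Lemma ecoefE_tail a m n : odd_ge3 a -> all odd_ge3 m -> all odd_ge3 n -> size n = (size m).+1 ->
  ecoef (a :: m) n = (a :: m == n)%:R + ecoef_tail a m n.
Proof.
move=> oka okm okn sz; rewrite ecoefE //; last by case/andP: oka.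
by rewrite scoef_ihara_terms (@map_pred_inj (a :: m)) //= oka.
Qed.

Lemma sum_Sset_delta N r n (f : seq nat -> rat) : n \in Sset N r ->
  \sum_(m <- Sset N r) f m * (m == n)%:R = f n.
Proof.
move=> nS; rewrite (bigD1_seq n) ?Sset_uniq //= eqxx mulr1 big1 ?addr0 // => m /negPf ->.
by rewrite mulr0.
Qed.

Lemma odd_ge3_pred_eq a b : odd_ge3 a -> odd_ge3 b -> (a.-1 == b.-1) = (a == b).
Proof. by case: a b => [|a] [|b]. Qed.

(** In e(m; n) the head term and the first edge together form the period relation and sum to 0
    against f. What remains carries m_2 to n_1 and lets m_1 act on the tail. E^(r-1) does the same
    with m_1 and m_2 exchanged, apart from its head term, which gives back f n. *)
Lemma actE_Fmx N r f n : wcond f -> n \in Sset N r.+2 ->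
  actE r.+2 r.+2 f n - f n = - actE r.+2 r.+1 f n.
Proof.
move=> fW nS; have [u [v [n' [nE oku okv _ n'S]]]] := SsetSS nS.
have okn' : all odd_ge3 n' by move: n'S; rewrite mem_Sset => /and3P[].
have szn' : size n' = r by exact: size_Sset n'S.
have okS (K p : nat) (t : seq nat) : t \in Sset K p -> all odd_ge3 t.
  by rewrite mem_Sset => /and3P[].
pose T a s := ecoef_tail a s (v :: n').
have opr : actE r.+2 r.+2 f n =
    \sum_(m <- Sset N r.+2) f m * (T (head 0%N m) (drop 2 m) *+ (nth 0%N m 1 == u)).
  transitivity (\sum_(m <- Sset N (2 + r)) f m * ((m == n)%:R
      + Bc (e0 m) (e1 m) u.-1 v.-1 * (drop 2 m == n')%:R
      + T (head 0%N m) (drop 2 m) *+ (nth 0%N m 1 == u))).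
    rewrite /actE (sumn_Sset nS) big_seq [RHS]big_seq; apply: eq_bigr => m mS.
    have [a [b [t [-> oka okb _ tS]]]] := SsetSS mS.
    have okt := okS _ _ _ tS.
    rewrite subnn !take0 eqxx !drop0 ecoefE_tail ?(okS _ _ _ nS) ?(size_Sset nS) //=; first last.
    - by rewrite (size_Sset tS).
    - by rewrite okb.
    rewrite nE /ecoef_tail [map _ _]/= [map predn (u :: _)]/= scoef_ihara_tail_cons.
    rewrite map_pred_inj // drop0 -addrA; congr (_ * (_ + (_ + _))).
      by rewrite mulr_natr.
    by rewrite odd_ge3_pred_eq.
  under eq_bigr do rewrite mulrDr; rewrite big_split /= [X in X + _](_ : _ = 0) ?add0r //.
  rewrite (@big_Sset_cat N 2 r) big1 // => K _; rewrite exchange_big big1_seq //= => t tS.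
  have [tn|tn] := eqVneq t n'; last first.
    rewrite big1_seq // => q /= /Sset2[a [b [-> _ _]]] /=.
    by rewrite drop0 nE !eqseq_cons (negPf tn) !andbF mulr0 addr0 mulr0.
  rewrite -[RHS](@Wc_coef K _ u.-1 v.-1 (fW K t)) big_seq [RHS]big_seq.
  apply: eq_bigr => q /Sset2[a [b [-> oka okb]]] /=.
  rewrite /e0 /e1 /= drop0 tn eqxx mulr1 nE !eqseq_cons eqxx !andbT.
  by rewrite !odd_ge3_pred_eq.
have -> : actE r.+2 r.+1 f n =
    f n + \sum_(m <- Sset N r.+2) f m * (T (nth 0%N m 1) (drop 2 m) *+ (head 0%N m == u)).
  rewrite -(sum_Sset_delta f nS) -big_split /actE (sumn_Sset nS) /= big_seq [RHS]big_seq.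
  apply: eq_bigr => m mS; have [a [b [t [-> oka okb _ tS]]]] := SsetSS mS.
  have okt := okS _ _ _ tS.
  rewrite subSnn -mulrDr; congr (_ * _); rewrite nE /= drop0 !eqseq_cons andbT.
  case: (a =P u) => _ /=; last by rewrite addr0.
  by rewrite ecoefE_tail ?eqseq_cons //= ?okv // szn' (size_Sset tS).
(* Exchanging the first two entries of m matches the two remaining sums, and antisymmetry of f
   supplies the sign. *)
rewrite opr -big_Sset_swap opprD addrC; congr (_ + _); rewrite -sumrN big_seq [RHS]big_seq.
apply: eq_bigr => m /SsetSS[a [b [t [-> oka okb _ _]]]] /=.
by rewrite (wcond_anti _ fW okb oka) mulNr.
Qed.

Lemma mkrow_Fmx N r f : wcond f ->
  mkrow N r.+2 f *m Fmx N r.+2 = mkrow N r.+2 (fun m => - actE r.+2 r.+1 f m).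
Proof.
move=> fW; rewrite mulmxBr mulmx1 mkrow_mulE.
by apply/rowP => i; rewrite !mxE (actE_Fmx fW (Selt_mem i)).
Qed.

Lemma actE_wcond_inj N r f : hypH -> wcond f ->
  {in Sset N r.+2, actE r.+2 r.+1 f =1 fun=> 0} -> {in Sset N r.+2, f =1 fun=> 0}.
Proof.
move=> H fW f0; apply/mkrowP.
(* (H) is applied to f and the zero row, on both of which [Fmx] acts as minus the next smaller
   E^(j). *)
have W0 : wcond (fun=> 0).
  by move=> K t; split=> [a b _ _|x y]; rewrite ?oppr0 // big1 // => q _; rewrite mul0r.
apply: (H N r.+2) => //; try exact: wcond_inW.
rewrite !mkrow_Fmx //; apply/mkrowP => m mS; rewrite f0 // /actE big1 // => n _.
by rewrite mul0r.
Qed.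

(** * Products of two consecutive matrices E^(j) *)

Arguments Sset : simpl never.

Lemma sumn_succ s : sumn (map succn s) = (sumn s + size s)%N.
Proof. by elim: s => //= a s ->; lia. Qed.

Lemma sumn_pred s : all odd_ge3 s -> sumn s = (sumn (map predn s) + size s)%N.
Proof. by elim: s => [|[|a] s IH] //= /andP[_ /IH ->]; lia. Qed.

Lemma succ_predK s : map predn (map succn s) = s.
Proof. by rewrite -map_comp map_id. Qed.

Lemma succ_Sset s M k : all even_gt0 s -> size s = k -> (sumn s + k = M)%N ->
  map succn s \in Sset M k.
Proof.
move=> evs <- <-; rewrite mem_Sset size_map sumn_succ !eqxx /=.
apply/allP => a /mapP[b /(allP evs) /andP[b0 eb] ->].
by case: b b0 eb => [|[|b]] // _ /= eb; rewrite /odd_ge3 /= eb.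
Qed.

Lemma sum_supported M k (p : mpoly) (h : seq nat -> rat) :
  all (fun t : mterm => size t.2 == k) p ->
  (forall s, size s = k -> h s != 0 -> all even_gt0 s /\ (sumn s + k = M)%N) ->
  \sum_(t <- p) t.1 * h t.2 =
  \sum_(s <- Sset M k) scoef p (map predn s) * h (map predn s).
Proof.
move=> /allP szp hS; under [RHS]eq_bigr do rewrite /scoef mulr_suml big_mkcond /=.
rewrite exchange_big big_seq [RHS]big_seq; apply: eq_bigr => t /szp/eqP szt.
have [h0|hn0] := eqVneq (h t.2) 0.
  by rewrite h0 mulr0 big1 // => s _; case: eqP => [<-|//]; rewrite h0 mulr0.
have [evt st] := hS _ szt hn0; have tS := succ_Sset evt szt st.
rewrite (bigD1_seq _ tS) ?Sset_uniq //= succ_predK eqxx big_seq_cond big1 ?addr0 // => s.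
move=> /andP[sS ns]; case: eqP => // ts; case/eqP: ns; apply/eqP.
move: sS; rewrite mem_Sset => /and3P[_ _ oks].
rewrite ts; elim: s oks {ts} => [|[|a] s IH] //= /andP[_ oks].
by rewrite eqseq_cons eqxx IH.
Qed.

(* f1 o (f2 o g) for the three monomials with exponents given by [m]. *)
Definition icomp (m : seq nat) : mpoly :=
  flatten [seq mscale t.1 (ihara_terms (e0 m) t.2) | t <- ihara_terms (e1 m) (map predn (drop 2 m))].

Lemma size_icomp m : all (fun t : mterm => size t.2 == (size (drop 2 m)).+2) (icomp m).
Proof.
apply/allP => t /flattenP[l /mapP[u uS ->] /mapP[t' t'S ->]] /=.
by rewrite (eqP (allP (size_ihara_terms _ _) _ t'S)) (eqP (allP (size_ihara_terms _ _) _ uS)) size_map.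
Qed.

Lemma ev_icomp x a k (p : mpoly) : all (fun t : mterm => size t.2 == k) p ->
  ev x (flatten [seq mscale t.1 (ihara_terms a t.2) | t <- p]) = x 0%N ^+ a * ev (x \o S) p
  + \sum_(i < k) (x i.+1 - x i) ^+ a * (ev (x \o bump i.+1) p - ev (x \o bump i) p).
Proof.
move=> /allP szp; under [in RHS]eq_bigr do rewrite /ev -sumrB mulr_sumr.
rewrite exchange_big ev_flatten big_map [ev (x \o S) p]/ev mulr_sumr -big_split.
rewrite big_seq [RHS]big_seq; apply: eq_bigr => t /szp /eqP szt.
cbv beta; rewrite ev_scale ev_ihara_terms ev_ihara_tail szt mulrDr mulr_sumr; congr (_ + _); first by ring.
by apply: eq_bigr => i _; ring.
Qed.

(* The product of matrices only sums over intermediate indices in [Sset], but the other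
   exponents do not contribute, by [ihara_terms_support]. *)
Lemma actE_actE N r f n : n \in Sset N r.+2 ->
  actE r.+2 r.+2 (actE r.+2 r.+1 f) n =
  \sum_(m <- Sset N r.+2) f m * scoef (icomp m) (map predn n).
Proof.
move=> nS; rewrite {1}/actE (sumn_Sset nS) subnn.
under eq_big_seq => n' n'S.
  rewrite !take0 eqxx !drop0 /actE (sumn_Sset n'S) subSnn mulr_suml; over.
rewrite exchange_big big_seq [RHS]big_seq; apply: eq_bigr => m mS.
have okS (K p : nat) (t : seq nat) : t \in Sset K p -> all odd_ge3 t.
  by rewrite mem_Sset => /and3P[].
have [a [b [t [mE oka okb abN tS]]]] := SsetSS mS.
transitivity (f m * \sum_(s <- Sset (N - a) r.+1) ecoef (b :: t) s * ecoef (a :: s) n).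
  rewrite -(big_Sset_head _ (fun n' => ecoef (b :: t) (behead n') * ecoef n' n)) //; last lia.
  rewrite mulr_sumr [RHS]big_mkcond big_seq [RHS]big_seq; apply: eq_bigr => n'.
  move=> /SsetS[a' [s [-> oka' _ sS]]]; rewrite mE /= !take0 !drop0 eqseq_cons andbT eq_sym.
  by case: eqP => [->|_]; rewrite ?mulr0 ?mul0r ?mulrA.
congr (_ * _); rewrite /icomp scoef_flatten big_map.
under [RHS]eq_bigr do rewrite scoef_scale.
have szt := size_Sset tS.
rewrite mE /e0 /e1 /= drop0 (@sum_supported (N - a) r.+1 _ (fun s => scoef (ihara_terms a.-1 s) (map predn n))).
- rewrite big_seq [RHS]big_seq; apply: eq_bigr => s sS; have := size_Sset sS => szs.
  rewrite !ecoefE ?szt ?szs ?(size_Sset nS) //; first by case/andP: oka.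
  by case/andP: okb.
- have := size_ihara_terms b.-1 (map predn t); by rewrite size_map szt.
move=> s szs /ihara_terms_support[].
- by case: a oka {mE abN tS} => [|a] // /andP[].
- exact/odd_ge3_pred/(okS _ _ _ nS).
- by rewrite size_map (size_Sset nS) szs.
move=> evs sE; split=> //; have := sumn_pred (okS _ _ _ nS).
rewrite (size_Sset nS) (sumn_Sset nS); case: a oka abN sE {mE tS} => [|a] // _; lia.
Qed.

(** P(X, Y; ys) + P(Y, X; ys) for the polynomial P with coefficients f, where [ys] lists the values
    of the other variables. *)
Definition antisum N r (f : seq nat -> rat) (X Y : rat) (ys : seq rat) : rat :=
  \sum_(m <- Sset N r.+2) f m * ((X ^+ e0 m * Y ^+ e1 m + Y ^+ e0 m * X ^+ e1 m)
                                 * mon (nth 0 ys) (map predn (drop 2 m))).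

(** P(X, Y; ys) - P(Z, Y; ys) + P(Z, X; ys). Z is kept apart from Y - X so that every difference can
    be entered in the form it has in the action, and equal powers match as they stand. *)
Definition relsum N r (f : seq nat -> rat) (X Y Z : rat) (ys : seq rat) : rat :=
  \sum_(m <- Sset N r.+2)
    f m * ((X ^+ e0 m * Y ^+ e1 m - Z ^+ e0 m * Y ^+ e1 m + Z ^+ e0 m * X ^+ e1 m)
           * mon (nth 0 ys) (map predn (drop 2 m))).

Lemma antisum0 N r f X Y ys : wcond f -> antisum N r f X Y ys = 0.
Proof.
move=> fW; rewrite /antisum.
under eq_bigr do rewrite mulrDl mulrDr.
rewrite big_split /= -[X in _ + X]big_Sset_swap -big_split big_seq big1 //= => m.
move=> /SsetSS[a [b [t [-> oka okb _ _]]]].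
by rewrite /e0 /e1 /= (wcond_anti _ fW oka okb); ring.
Qed.

Lemma relsum0 N r f X Y Z ys : wcond f -> Z = Y - X -> relsum N r f X Y Z ys = 0.
Proof.
move=> fW ->; rewrite /relsum (@big_Sset_cat N 2 r) big1 // => K _.
rewrite exchange_big big1 //= => t _.
rewrite -[RHS](mulr0 (mon (nth 0 ys) (map predn t))) -[X in _ = _ * X]((fW K t).2 X Y).
rewrite mulr_sumr big_seq [RHS]big_seq; apply: eq_bigr => q /Sset2[a [b [-> _ _]]].
by rewrite /kap /e0 /e1 /= drop0; ring.
Qed.


(* In f1 o (f2 o g) two vertices are removed from the path 0, x_0, x_1, ..., each along an
   adjacent edge.  For a fixed pair of removed vertices, the terms with two independent
   edges cancel by antisymmetry, and the remaining ones (for neighbouring vertices) group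
   into instances of the period relation. *)
Lemma icomp_eq0_depth3 N f x : wcond f -> \sum_(m <- Sset N 3) f m * ev x (icomp m) = 0.
Proof.
move=> fW; pose A := antisum N 1 f; pose R := relsum N 1 f.
transitivity (R (x 0%N) (x 1%N) (x 1%N - x 0%N) [:: x 2%N]
    + R (x 2%N - x 1%N) (x 2%N - x 0%N) (x 1%N - x 0%N) [:: x 2%N]
    - A (x 0%N) (x 2%N - x 1%N) [:: x 2%N]
    + A (x 0%N) (x 2%N - x 1%N) [:: x 1%N]
    - A (x 1%N - x 0%N) (x 2%N - x 1%N) [:: x 1%N]
    + R (x 1%N - x 0%N) (x 2%N - x 0%N) (x 2%N - x 1%N) [:: x 0%N]).
  rewrite /A /R /antisum /relsum -?sumrN -!big_split big_seq [RHS]big_seq.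
  apply: eq_bigr => m /SsetSS[a [b [t [-> _ _ _ /SsetS[c [s [-> _ _ sS]]]]]]].
  have /nilP -> : nilp s by rewrite /nilp (size_Sset sS).
  rewrite /icomp (@ev_icomp _ _ 2); last exact: (size_ihara_terms _ [:: c.-1]).
  rewrite !big_ord_recl big_ord0 !ev_ihara_terms !ev_ihara_tail.
  by rewrite /e0 /e1 /= !big_ord_recl !big_ord0 /bump /=; ring.
by rewrite /A /R !antisum0 // !relsum0 ?oppr0 ?addr0 //; ring.
Qed.

Lemma icomp_eq0_depth4 N f x : wcond f -> \sum_(m <- Sset N 4) f m * ev x (icomp m) = 0.
Proof.
move=> fW; pose A := antisum N 2 f; pose R := relsum N 2 f.
(* The list closing each term holds the two surviving variables. When neighbours are removed, the
   relation occurs twice for the pairs x_0, x_1 and x_1, x_2, but once for x_2, x_3, where the path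
   ends. *)
transitivity (R (x 0%N) (x 1%N) (x 1%N - x 0%N) [:: x 2%N; x 3%N]
    + R (x 2%N - x 1%N) (x 2%N - x 0%N) (x 1%N - x 0%N) [:: x 2%N; x 3%N]
    - A (x 0%N) (x 2%N - x 1%N) [:: x 2%N; x 3%N]
    + A (x 0%N) (x 2%N - x 1%N) [:: x 1%N; x 3%N]
    - A (x 0%N) (x 3%N - x 2%N) [:: x 1%N; x 3%N]
    - A (x 1%N - x 0%N) (x 2%N - x 1%N) [:: x 1%N; x 3%N]
    + A (x 1%N - x 0%N) (x 3%N - x 2%N) [:: x 1%N; x 3%N]
    + A (x 0%N) (x 3%N - x 2%N) [:: x 1%N; x 2%N]
    - A (x 1%N - x 0%N) (x 3%N - x 2%N) [:: x 1%N; x 2%N]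
    + R (x 1%N - x 0%N) (x 2%N - x 0%N) (x 2%N - x 1%N) [:: x 0%N; x 3%N]
    + R (x 3%N - x 2%N) (x 3%N - x 1%N) (x 2%N - x 1%N) [:: x 0%N; x 3%N]
    - A (x 1%N - x 0%N) (x 3%N - x 2%N) [:: x 0%N; x 3%N]
    + A (x 1%N - x 0%N) (x 3%N - x 2%N) [:: x 0%N; x 2%N]
    - A (x 2%N - x 1%N) (x 3%N - x 2%N) [:: x 0%N; x 2%N]
    + R (x 2%N - x 1%N) (x 3%N - x 1%N) (x 3%N - x 2%N) [:: x 0%N; x 1%N]).
  rewrite /A /R /antisum /relsum -?sumrN -!big_split big_seq [RHS]big_seq.
  apply: eq_bigr => m /SsetSS[a [b [t [-> _ _ _ /SsetSS[c [d [s [-> _ _ _ sS]]]]]]]].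
  have /nilP -> : nilp s by rewrite /nilp (size_Sset sS).
  rewrite /icomp (@ev_icomp _ _ 3); last exact: (size_ihara_terms _ [:: c.-1; d.-1]).
  rewrite !big_ord_recl big_ord0 !ev_ihara_terms !ev_ihara_tail.
  by rewrite /e0 /e1 /= !big_ord_recl !big_ord0 /bump /=; ring.
by rewrite /A /R !antisum0 // !relsum0 ?oppr0 ?addr0 //; ring.
Qed.

(** * Existence of period polynomials *)

Lemma poly_eq_off (c : rat) (p q : {poly rat}) :
  (forall x, x != c -> p.[x] = q.[x]) -> p = q.
Proof.
move=> pq; have: (p - q) * ('X - c%:P) = 0.
  apply: horner_eq0 => a; rewrite hornerM hornerXsubC hornerD hornerN.
  by have [->|/pq ->] := eqVneq a c; rewrite subrr ?mulr0 ?mul0r.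
by move=> /eqP; rewrite mulf_eq0 polyXsubC_eq0 orbF subr_eq0 => /eqP.
Qed.

Lemma odd_poly_coef (q : {poly rat}) k :
  (forall x, q.[- x] = - q.[x]) -> ~~ odd k -> q`_k = 0.
Proof.
move=> qodd ek; have qN : \poly_(i < size q) ((-1) ^+ i * q`_i) = - q.
  apply/eqP; rewrite -subr_eq0; apply/eqP/horner_eq0 => x.
  rewrite hornerD !hornerN -qodd horner_poly [in X in _ - X]horner_coef -sumrB big1 // => i _.
  by rewrite [(- x) ^+ i]exprNn; ring.
have := congr1 (fun p : {poly rat} => p`_k) qN.
rewrite coef_poly coefN -signr_odd (negPf ek) expr0 mul1r.
case: ltnP => [_|le _]; last by rewrite nth_default.
by move=> /eqP; rewrite -subr_eq0 opprK -mulr2n -mulr_natr mulf_eq0 orbF => /eqP.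
Qed.

(** The substitution x -> (x - 1) / (3x + 1) sends 1 to 0, so a zero of order M at 0 produces one at
    1; oddness carries it to -1. *)
Lemma dvdp_symmetric (q : {poly rat}) (d M : nat) :
  (forall x, q.[- x] = - q.[x]) -> (size q <= d.+1)%N -> (M <= d)%N ->
  (forall x, 3 * x + 1 != 0 ->
     2 ^+ d * q.[x] = (3 * x + 1) ^+ d * q.[(x - 1) / (3 * x + 1)]) ->
  'X^M %| q -> ('X - 1%:P) ^+ M %| q /\ ('X - (-1)%:P) ^+ M %| q.
Proof.
move=> qodd szq leMd qsym /dvdpP[r qE].
have szr : (size r <= (d - M).+1)%N.
  have [->|r0] := eqVneq r 0; first by rewrite size_poly0.
  move: szq; rewrite qE size_Mmonic ?monicXn // size_polyXn. by move: (size r) => k; lia.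
(* r((x - 1) / (3x + 1)) with its denominator cleared by (3x + 1)^(d - M). *)
pose r' := \sum_(j < size r) r`_j *: (('X - 1%:P) ^+ j * (3 *: 'X + 1%:P) ^+ (d - M - j)).
have q'E : 2 ^+ d *: q = r' * ('X - 1%:P) ^+ M.
  apply: (@poly_eq_off (- 3^-1)) => x xn.
  have x1 : 3 * x + 1 != 0.
    apply: contraNneq xn => x1; apply/eqP; have -> : x = ((3 * x + 1) - 1) / 3 by field.
    by rewrite x1; field.
  rewrite hornerZ qsym // qE hornerM hornerXn hornerM horner_exp hornerXsubC.
  rewrite expr_div_n -{1}(subnKC leMd) exprD.
  have -> : r'.[x] = (3 * x + 1) ^+ (d - M) * r.[(x - 1) / (3 * x + 1)].
    rewrite [in RHS]horner_coef mulr_sumr horner_sum; apply: eq_bigr => j _.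
    rewrite hornerZ hornerM !horner_exp !(hornerXsubC, hornerD, hornerZ, hornerX, hornerC) expr_div_n.
    have lej : (j <= d - M)%N by have := ltn_ord j; lia.
    have -> : (3 * x + 1) ^+ (d - M) = (3 * x + 1) ^+ (d - M - j) * (3 * x + 1) ^+ j.
      by rewrite -exprD subnK.
    field.
    by rewrite expf_neq0.
  by field; rewrite expf_neq0.
have d1 : ('X - 1%:P) ^+ M %| q.
  by rewrite -(@dvdpZr _ (2 ^+ d)) ?expf_neq0 // q'E dvdp_mulIr.
split=> //; have /dvdpP[s sE] := d1.
apply/dvdpP; exists ((- (-1) ^+ M) *: (s \Po - 'X)).
apply/eqP; rewrite -subr_eq0; apply/eqP/horner_eq0 => x.
rewrite hornerD hornerN -[q.[x]]opprK -qodd sE !hornerM hornerZ !horner_exp !hornerXsubC.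
rewrite horner_comp hornerN hornerX.
have -> : - x - 1 = - (x - -1) by ring.
by rewrite [(- (x - -1)) ^+ M]exprNn; ring.
Qed.

(* If the first odd coefficients vanish then q vanishes to order M = 2t + 1 at 0, hence by
   symmetry at 1 and -1; together with the simple roots 1/3 and -1/3 this exceeds the
   degree. *)
Lemma symmetric_poly_eq0 (q : {poly rat}) (d t : nat) :
  ~~ odd d -> (d < 6 * t + 6)%N ->
  (forall x, q.[- x] = - q.[x]) -> (size q <= d.+1)%N ->
  (forall x, 3 * x + 1 != 0 ->
     2 ^+ d * q.[x] = (3 * x + 1) ^+ d * q.[(x - 1) / (3 * x + 1)]) ->
  root q (3^-1) -> (forall i, (i < t)%N -> q`_i.*2.+1 = 0) -> q = 0.
Proof.
move=> ed ltd qodd szq qsym qroot qt; apply/eqP; apply: contraT => q0.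
pose M := t.*2.+1.
(* An odd polynomial has no term of even degree d. This is the simple zero at infinity, where B = C,
   just as 1/3 and -1/3 are the points A = B and A = C. *)
have szd : (size q <= d)%N.
  rewrite leqNgt; apply/negP => ltq.
  have sq : size q = d.+1 by apply/eqP; rewrite eqn_leq szq.
  by move: q0; rewrite -lead_coef_eq0 lead_coefE sq /= odd_poly_coef // eqxx.
have dX : 'X^M %| q.
  rewrite -(poly_take_drop M q); have -> : take_poly M q = 0.
    apply/polyP => k; rewrite coef_take_poly coef0; case: ltnP => // ltk.
    have [ok|/odd_poly_coef->//] := boolP (odd k).
    rewrite -(odd_double_half k) ok qt //; move: ltk; rewrite /M -{1}(odd_double_half k) ok; lia.
  by rewrite add0r dvdp_mulIr.
have leMd : (M <= d)%N.
  apply: leq_trans szd; have := dvdp_leq q0 dX; rewrite size_polyXn; exact: ltnW.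
have [d1 d2] := dvdp_symmetric qodd szq leMd qsym dX.
have d3 : 'X - (3^-1)%:P %| q by rewrite dvdp_XsubCl.
have d4 : 'X - (- 3^-1)%:P %| q by rewrite dvdp_XsubCl rootE qodd (eqP qroot) oppr0.
(* [D] has degree 3(2t + 1) + 2 = 6t + 5, while q has degree at most d - 1 <= 6t + 4. *)
pose D : {poly rat} :=
  'X^M * ('X - 1%:P) ^+ M * ('X - (-1)%:P) ^+ M * ('X - (3^-1)%:P) * ('X - (- 3^-1)%:P).
have nzX (p : {poly rat}) a : root (p ^+ M) a = root p a.
  by rewrite !rootE horner_exp expf_eq0.
have dD : D %| q.
  rewrite /D !Gauss_dvdp ?dX ?d1 ?d2 ?d3 ?d4 //; do ?apply: coprimep_expr;
    rewrite coprimep_XsubC ?rootM ?nzX ?rootX ?root_XsubC //.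
have := dvdp_leq q0 dD; rewrite /D.
have mon_pow a : ('X - a%:P : {poly rat}) ^+ M \is monic by rewrite monic_exp ?monicXsubC.
rewrite !size_Mmonic ?monic_neq0 ?monicMl ?monicXn ?mon_pow ?monicXsubC //.
rewrite size_polyXn !size_exp_XsubC !size_XsubC.
by move: szd; move: (size q) => k; rewrite /M; lia.
Qed.

Definition alt (R : comNzRingType) (p r : nat) (x y : R) : R := x ^+ p * y ^+ r - x ^+ r * y ^+ p.

(** The positive even exponents. For even d, the recurring bound h <= (d - 1) / 4 says that [pex j]
    < d - [pex j] for all j < h, so the binomials [alt] are nonzero and share no monomials. *)
Definition pex (j : nat) := j.*2.+2.
Arguments pex : simpl never.

(* The antisymmetrization a(A, B) + a(B, C) + a(C, A) on the plane A + B + C = 0, restricted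
   to the line A = 2x, B = 1 - x, C = - 1 - x, on which exchanging B and C is x |-> - x. *)
Definition cubic (d j : nat) : {poly rat} :=
  let a := alt (pex j) (d - pex j) in
  a (2 *: 'X) (1%:P - 'X) + a (1%:P - 'X) (1%:P + 'X) + a (1%:P + 'X) (2 *: 'X).

Definition altsum (d h : nat) (u : 'rV[rat]_h) (x y : rat) : rat :=
  \sum_j u 0 j * alt (pex j) (d - pex j) x y.

Definition cubsum (d h : nat) (u : 'rV[rat]_h) : {poly rat} := \sum_j u 0 j *: cubic d j.

Lemma altsum_anti d h u x y : @altsum d h u x y = - altsum d u y x.
Proof. by rewrite /altsum -sumrN; apply: eq_bigr => j _; rewrite /alt; ring. Qed.

Lemma even_pex j : odd (pex j) = false.
Proof. by rewrite /pex /= odd_double. Qed.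

Lemma exprN_even (x : rat) n : ~~ odd n -> (- x) ^+ n = x ^+ n.
Proof. by move=> en; rewrite exprNn -signr_odd (negPf en) mul1r. Qed.

Lemma altsum_even d h u x y : ~~ odd d -> (h <= d.-1 %/ 4)%N ->
  @altsum d h u (- x) y = altsum d u x y.
Proof.
move=> ed leh; apply: eq_bigr => j _; have ltj := ltn_ord j.
have er : odd (d - pex j) = false by rewrite oddB ?(negPf ed) ?even_pex // /pex; lia.
by rewrite /alt !exprN_even ?even_pex ?er.
Qed.

Lemma altsum_scale d h u c x y : (h <= d.-1 %/ 4)%N ->
  @altsum d h u (c * x) (c * y) = c ^+ d * altsum d u x y.
Proof.
move=> leh; rewrite /altsum mulr_sumr; apply: eq_bigr => j _; have ltj := ltn_ord j.
have le : (pex j <= d)%N by rewrite /pex; lia.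
by rewrite /alt -{3}(subnKC le) exprD !exprMn; ring.
Qed.

Lemma cubsumE d h u x : (@cubsum d h u).[x] =
  altsum d u (2 * x) (1 - x) + altsum d u (1 - x) (1 + x) + altsum d u (1 + x) (2 * x).
Proof.
rewrite horner_sum -!big_split; apply: eq_bigr => j _ /=.
rewrite hornerZ /cubic /alt; move: (pex j) (d - pex j)%N => p r.
rewrite !(hornerD, hornerN, hornerM, horner_exp, hornerZ, hornerX, hornerC).
by ring.
Qed.

Lemma size_cubsum d h u : (h <= d.-1 %/ 4)%N -> (size (@cubsum d h u) <= d.+1)%N.
Proof.
move=> leh; have szlin (a b : rat) : (size (a *: 'X + b%:P)%R <= 2)%N.
  apply: leq_trans (size_polyD _ _) _; rewrite geq_max (leq_trans (size_polyC_leq1 _)) // andbT.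
  by apply: leq_trans (size_scale_leq _ _) _; rewrite size_polyX.
have szexp (p : {poly rat}) n : (size p <= 2)%N -> (size (p ^+ n) <= n.+1)%N.
  move=> szp; apply: leq_trans (size_poly_exp_leq _ _) _; rewrite ltnS.
  by rewrite -[leqRHS]mul1n leq_mul2r; case: (size p) szp => [|[|[|]]] //= _; rewrite orbT.
have szalt (p q : {poly rat}) k n : (size p <= 2)%N -> (size q <= 2)%N ->
    (size (alt k n p q) <= (k + n).+1)%N.
  move=> szp szq; apply: leq_trans (size_polyD _ _) _; rewrite size_polyN geq_max.
  have szm i j : (size (p ^+ i * q ^+ j)%R <= (i + j).+1)%N.
    apply: leq_trans (size_polyMleq _ _) _.
    by have := szexp p i szp; have := szexp q j szq; lia.
  by rewrite szm addnC szm.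
have l1 : (size (2 *: 'X : {poly rat})%R <= 2)%N by rewrite -[_ *: _]addr0 -polyC0 szlin.
have l2 : (size (1%:P - 'X : {poly rat})%R <= 2)%N by rewrite addrC -scaleN1r szlin.
have l3 : (size (1%:P + 'X : {poly rat})%R <= 2)%N by rewrite addrC -['X]scale1r szlin.
apply: leq_trans (size_sum _ _ _) _; apply/bigmax_leqP => j _.
have ltj := ltn_ord j; have le : (pex j <= d)%N by rewrite /pex; lia.
apply: leq_trans (size_scale_leq _ _) _; rewrite -[d in leqRHS](subnKC le).
rewrite /cubic; apply: leq_trans (size_polyD _ _) _; rewrite geq_max szalt // andbT.
by apply: leq_trans (size_polyD _ _) _; rewrite geq_max !szalt.
Qed.

Lemma cubsum_odd d h u x : ~~ odd d -> (h <= d.-1 %/ 4)%N ->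
  (@cubsum d h u).[- x] = - (cubsum d u).[x].
Proof.
move=> ed leh; rewrite !cubsumE mulrN !opprK altsum_even //.
rewrite [altsum d u (1 - x) (- _)]altsum_anti altsum_even // [altsum d u (2 * x) (1 + x)]altsum_anti.
by rewrite [altsum d u (1 + x) (1 - x)]altsum_anti; ring.
Qed.

Lemma cubsum_homog d h u x y : (h <= d.-1 %/ 4)%N -> y != 0 ->
  y ^+ d * (@cubsum d h u).[x / y] =
  altsum d u (2 * x) (y - x) + altsum d u (y - x) (y + x) + altsum d u (y + x) (2 * x).
Proof.
move=> leh y0; rewrite cubsumE !mulrDr -!altsum_scale //.
have -> : y * (2 * (x / y)) = 2 * x by field.
have -> : y * (1 - x / y) = y - x by field.
by have -> : y * (1 + x / y) = y + x by field.
Qed.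

(** In the coordinate x of the line, x -> (x - 1) / (3x + 1) is a cyclic permutation of A, B, C,
    under which the antisymmetrization is invariant; the powers of 2 and 3x + 1 come from
    homogeneity. *)
Lemma cubsum_sym d h u x : ~~ odd d -> (h <= d.-1 %/ 4)%N -> 3 * x + 1 != 0 ->
  2 ^+ d * (@cubsum d h u).[x] = (3 * x + 1) ^+ d * (cubsum d u).[(x - 1) / (3 * x + 1)].
Proof.
move=> ed leh x0; rewrite cubsum_homog // cubsumE [2 ^+ d * _]mulrDr [2 ^+ d * (_ + _)]mulrDr -!altsum_scale //.
have -> : 2 * (x - 1) = - (2 * (1 - x)) by ring.
have -> : 3 * x + 1 - (x - 1) = 2 * (1 + x) by ring.
have -> : 3 * x + 1 + (x - 1) = 2 * (2 * x) by ring.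
rewrite altsum_even // [altsum d u (2 * (2 * x)) (- _)]altsum_anti altsum_even //.
by rewrite -altsum_anti; ring.
Qed.

(** At x = 1/3 one has A = B, where an antisymmetric function vanishes. *)
Lemma cubsum_root d h u : root (@cubsum d h u) 3^-1.
Proof.
rewrite rootE cubsumE.
have -> : (1 - 3^-1 : rat) = 2 * 3^-1 by field.
rewrite [X in _ + X]altsum_anti addrK.
by have := altsum_anti d u (2 * 3^-1) (2 * 3^-1); lra.
Qed.

Definition cub_coefs (d h t : nat) : 'M[rat]_(h, t) := \matrix_(j, i) (cubic d j)`_i.*2.+1.

Lemma cubsum_eq0 d h t (u : 'rV_h) : ~~ odd d -> (h <= d.-1 %/ 4)%N -> (d < 6 * t + 6)%N ->
  u *m cub_coefs d h t = 0 -> cubsum d u = 0.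
Proof.
move=> ed leh ltd u0; apply: (@symmetric_poly_eq0 _ d t) => //.
- by move=> x; exact: cubsum_odd.
- exact: size_cubsum.
- by move=> x; exact: cubsum_sym.
- exact: cubsum_root.
move=> i lti; have := congr1 (fun v : 'rV_t => v 0 (Ordinal lti)) u0; rewrite !mxE /= => s0.
by rewrite -[RHS]s0 coef_sum; apply: eq_bigr => j _; rewrite coefZ mxE.
Qed.

(** By homogeneity, vanishing on the line extends to the plane. The point A = x, B = - y, C = y - x
    then gives the period relation, since [altsum] is even and antisymmetric. *)
Lemma altsum_rel d h (u : 'rV_h) x y : ~~ odd d -> (h <= d.-1 %/ 4)%N ->
  cubsum d u = 0 -> altsum d u x y - altsum d u (y - x) y + altsum d u (y - x) x = 0.
Proof.
move=> ed leh u0; have [V0|Vn0] := eqVneq (x / 2 - y) 0.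
  (* The direction B = C is not met by the affine line; there the relation follows from antisymmetry
     alone. *)
  have -> : x = 2 * y by lra.
  have -> : y - 2 * y = - y by ring.
  rewrite !altsum_even // [altsum d u y (2 * y)]altsum_anti.
  by have := altsum_anti d u y y; lra.
have := cubsum_homog u (x / 2) leh Vn0; rewrite u0 horner0 mulr0.
have -> : 2 * (x / 2) = x by field.
have -> : x / 2 - y - x / 2 = - y by ring.
have -> : x / 2 - y + x / 2 = - (y - x) by field.
rewrite !altsum_even // => ->.
rewrite [altsum d u x (- y)]altsum_anti altsum_even // [altsum d u y (- (y - x))]altsum_anti.
by rewrite altsum_even // [altsum d u x y]altsum_anti; ring.
Qed.

(** * Action of E^(2), E^(3), E^(4) on the three subspaces *)

Lemma actE_actE_eq0 N r f n :
  (forall x, \sum_(m <- Sset N r.+2) f m * ev x (icomp m) = 0) ->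
  n \in Sset N r.+2 -> actE r.+2 r.+2 (actE r.+2 r.+1 f) n = 0.
Proof.
move=> f0 nS; rewrite (actE_actE _ nS).
rewrite -[RHS](@scoef_ev0 r.+2 (flatten [seq mscale (f m) (icomp m) | m <- Sset N r.+2])
  _ _ (map predn n)); first last.
- by move=> x; rewrite ev_flatten big_map -[RHS](f0 x); apply: eq_bigr => m _; rewrite ev_scale.
- apply/allP => t /flattenP[l /mapP[m mS ->]] /mapP[t' t'm ->] /=.
  by rewrite (eqP (allP (size_icomp m) _ t'm)) size_drop (size_Sset mS) !subSS subn0.
by rewrite scoef_flatten big_map; apply: eq_bigr => m _; rewrite scoef_scale.
Qed.

Lemma actE_ext r j f g n : {in Sset (sumn n) r, f =1 g} -> actE r j f n = actE r j g n.
Proof.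
by move=> fg; rewrite /actE big_seq [RHS]big_seq; apply: eq_bigr => m /fg ->.
Qed.

Lemma actED r j f g n : actE r j (fun m => f m + g m) n = actE r j f n + actE r j g n.
Proof. by rewrite /actE -big_split; apply: eq_bigr => m _; rewrite mulrDl. Qed.

Lemma actE0 r j n : actE r j (fun=> 0) n = 0.
Proof. by rewrite /actE big1 // => m _; rewrite mul0r. Qed.

Lemma actE11 N f n : n \in Sset N 1 -> actE 1 1 f n = f n.
Proof.
move=> nS; rewrite -[RHS](sum_Sset_delta f nS) /actE (sumn_Sset nS) big_seq [RHS]big_seq.
have okS (t : seq nat) : t \in Sset N 1 -> all odd_ge3 t by rewrite mem_Sset => /and3P[].
apply: eq_bigr => m /[dup] /okS + /SsetS[a [t [mE oka _ tS]]]; rewrite subnn !take0 eqxx !drop0.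
have /nilP t0 : nilp t by rewrite /nilp (size_Sset tS).
rewrite mE t0 => _; congr (_ * _).
by rewrite ecoefE_tail ?(okS n nS) ?(size_Sset nS) // /ecoef_tail /scoef [map predn [::]]/= [ihara_tail _ _]/= big_nil addr0.
Qed.

(** E^(1) is the identity, so in depth 2 the formula P F = - P E^(1) reads P E = 0. *)
Lemma actE22_eq0 N f n : wcond f -> n \in Sset N 2 -> actE 2 2 f n = 0.
Proof.
move=> fW nS; have := actE_Fmx fW nS.
have [a [t [-> oka leaN tS]]] := SsetS nS.
by rewrite [actE 2 1 f _]actE_cons // (actE11 _ tS) => /eqP; rewrite subr_eq addNr => /eqP.
Qed.

Definition wmid (f : seq nat -> rat) := forall a, wcond (fun m => f (a :: m)).
Definition wlast (f : seq nat -> rat) := forall a b, wcond (fun m => f [:: a, b & m]).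

Lemma wlast_actE N f n : wlast f -> n \in Sset N 4 -> actE 4 2 f n = 0.
Proof.
move=> fW /SsetS[a [t [-> oka _ /SsetS[b [s [-> okb _ sS]]]]]].
by rewrite !actE_cons // (actE22_eq0 (fW a b) sS).
Qed.

Lemma wmid_actE N f n : wmid f -> n \in Sset N 4 -> actE 4 3 (actE 4 2 f) n = 0.
Proof.
move=> fW /SsetS[a [t [-> oka _ tS]]]; rewrite actE_cons //.
rewrite (@actE_ext _ _ _ (actE 3 2 (fun m => f (a :: m)))) => [|m _]; last by rewrite actE_cons.
by apply: (actE_actE_eq0 _ tS) => x; exact: icomp_eq0_depth3.
Qed.

Lemma actE_take2 f a b t :
  actE 4 2 f [:: a, b & t] = \sum_(s <- Sset (sumn t) 2) f [:: a, b & s] * ecoef s t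
    *+ (odd_ge3 a && odd_ge3 b).
Proof.
have [/andP[oka okb]|nok] := boolP (odd_ge3 a && odd_ge3 b).
  by rewrite !actE_cons // /actE subnn; apply: eq_bigr => s _; rewrite !take0 eqxx !drop0.
rewrite /actE [LHS]big1_seq ?big1 // => m /= /SsetSS[a' [b' [s [-> oka okb _ _]]]] /=.
rewrite !eqseq_cons; case: (a' =P a) => [aa|_]; last by rewrite mulr0.
case: (b' =P b) => [bb|_]; last by rewrite mulr0.
by rewrite -aa -bb oka okb in nok.
Qed.

(** E^(2) acts on the last two indices and the relation concerns the first two, so they do not
    interact. *)
Lemma wcond_actE f : wcond f -> wcond (actE 4 2 f).
Proof.
move=> fW K t; split=> [a b oka okb|x y].
  rewrite /= !actE_take2 oka okb -sumrN; apply: eq_bigr => s _.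
  by rewrite (wcond_anti _ fW oka okb) mulNr.
transitivity (\sum_(q <- Sset K 2) \sum_(s <- Sset (sumn t) 2)
    ecoef s t * (f (q ++ s) * kap q x y)).
  rewrite big_seq [RHS]big_seq; apply: eq_bigr => q /Sset2[a [b [-> oka okb]]].
  by rewrite /= actE_take2 oka okb mulr_suml; apply: eq_bigr => s _; rewrite mulr1n; ring.
rewrite exchange_big big1 //= => s _; rewrite -mulr_sumr.
by rewrite [X in _ * X](fW K s).2 mulr0.
Qed.

Lemma wcond_actE3 N f n : wcond f -> n \in Sset N 4 -> actE 4 4 (actE 4 3 f) n = 0.
Proof. by move=> fW; apply: actE_actE_eq0 => x; exact: icomp_eq0_depth4. Qed.

(** * Pivots *)

Definition altw (d h : nat) (u : 'rV[rat]_h) (m : seq nat) : rat :=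
  \sum_j u 0 j * ((m == [:: (pex j).+1; (d - pex j).+1])%:R
                  - (m == [:: (d - pex j).+1; (pex j).+1])%:R).

Lemma pex_Sset d h (j : 'I_h) : ~~ odd d -> (h <= d.-1 %/ 4)%N ->
  ([:: (pex j).+1; (d - pex j).+1] \in Sset d.+2 2)
  && ([:: (d - pex j).+1; (pex j).+1] \in Sset d.+2 2).
Proof.
move=> ed leh; have ltj := ltn_ord j; have le : ((pex j).+2 <= d)%N by rewrite /pex; lia.
have o1 : odd_ge3 (pex j).+1 by rewrite /odd_ge3 oddS even_pex.
have o2 : odd_ge3 (d - pex j).+1 by rewrite /odd_ge3 oddS oddB ?even_pex ?(negPf ed) //; lia.
by rewrite !mem_Sset /= o1 o2 !andbT; apply/andP; split; apply/eqP; lia.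
Qed.

Lemma Wc_altw d h (u : 'rV_h) : ~~ odd d -> (h <= d.-1 %/ 4)%N -> cubsum d u = 0 ->
  Wc d.+2 (altw d u).
Proof.
move=> ed leh u0; split=> [a b _ _|x y].
  rewrite /altw -sumrN; apply: eq_bigr => j _.
  by rewrite !eqseq_cons !andbT ![(b == _) && _]andbC; ring.
rewrite -[RHS](altsum_rel x y ed leh u0) /altw /altsum -!sumrN -!big_split /=.
under eq_bigr do rewrite mulr_suml.
rewrite exchange_big; apply: eq_bigr => j _ /=.
have /andP[P1 P2] := pex_Sset j ed leh.
transitivity (u 0 j * (kap [:: (pex j).+1; (d - pex j).+1] x y
                       - kap [:: (d - pex j).+1; (pex j).+1] x y)).
  rewrite -(sum_Sset_delta (fun q => kap q x y) P1) -(sum_Sset_delta (fun q => kap q x y) P2) -sumrB mulr_sumr.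
  by apply: eq_bigr => q _; ring.
by rewrite /kap /e0 /e1 /alt /=; ring.
Qed.

(** The dimension of the space of cusp forms of weight K for SL_2(Z). At K = 2 the truncated
    subtraction gives the correct value 0. *)
Definition cusp_dim (K : nat) : nat := if odd K then 0%N else (K %/ 12 - (K %% 12 == 2))%N.

Lemma rank_pivots (F : fieldType) n (A : 'M[F]_n) (P : pred 'I_n) :
  (forall i j, P j -> A i j = (i == j)%:R) -> (#|P| <= \rank A)%N.
Proof.
move=> AP; pose G : 'M[F]_(n, #|P|) := \matrix_(j, c) (j == enum_val c)%:R.
have GAG : G^T *m (A *m G) = 1%:M.
  apply/matrixP => c c'; rewrite !mxE (bigD1 (enum_val c)) //= !mxE eqxx mul1r.
  rewrite (bigD1 (enum_val c')) //= !mxE eqxx mulr1 big1 => [|j /negPf nj]; last first.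
    by rewrite !mxE nj mulr0.
  rewrite addr0 big1 => [|j /negPf nj]; last by rewrite !mxE nj mul0r.
  by rewrite addr0 AP ?(inj_eq enum_val_inj) //; exact: enum_valP.
rewrite -[X in (X <= _)%N](mxrank1 F) -GAG.
exact: leq_trans (mxrankM_maxr _ _) (mxrankM_maxl _ _).
Qed.

Definition altmx (d h : nat) : 'M[rat]_(h, Sidx d.+2 2) :=
  \matrix_(j, i) ((Selt i == [:: (pex j).+1; (d - pex j).+1])%:R
                  - (Selt i == [:: (d - pex j).+1; (pex j).+1])%:R).

Lemma mul_altmx d h (u : 'rV_h) i : (u *m altmx d h) 0 i = altw d u (Selt i).
Proof. by rewrite mxE; apply: eq_bigr => j _; rewrite mxE. Qed.

Lemma altmx_free d h : ~~ odd d -> (h <= d.-1 %/ 4)%N -> row_free (altmx d h).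
Proof.
move=> ed leh; apply/row_freeP.
exists (\matrix_(i, j) (Selt i == [:: (pex j).+1; (d - pex j).+1])%:R).
apply/matrixP => j j'; rewrite !mxE.
have /andP[P1 _] := pex_Sset j' ed leh.
under eq_bigr do rewrite !mxE.
rewrite (@sum_Selt _ _ (fun q => ((q == [:: (pex j).+1; (d - pex j).+1])%:R
                  - (q == [:: (d - pex j).+1; (pex j).+1])%:R)
                  * (q == [:: (pex j').+1; (d - pex j').+1])%:R)).
rewrite (sum_Sset_delta (fun q => (q == [:: (pex j).+1; (d - pex j).+1])%:R
                  - (q == [:: (d - pex j).+1; (pex j).+1])%:R) P1).
have lt1 := ltn_ord j; have lt2 := ltn_ord j'.
rewrite !eqseq_cons !andbT.
have -> : ((pex j').+1 == (d - pex j).+1) = false by apply/eqP; rewrite /pex; lia.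
rewrite subr0; congr (_%:R); congr nat_of_bool.
apply/andP/eqP => [[/eqP jj _]|->]; last by rewrite !eqxx.
by apply: val_inj; move: jj; rewrite /pex /=; lia.
Qed.

(* Row reduction of a basis of the kernel; this is stated in [Type] to be usable for all
   weights at once without choice. *)
Lemma period_pivots K :
  {Z : pred (seq nat) & {w : seq nat -> seq nat -> rat |
    [/\ count Z (Sset K 2) = cusp_dim K, forall q, Wc K (w q)
      & forall q m, Z m -> w q m = (q == m)%:R]}}.
Proof.
have [s0|s0] := posnP (cusp_dim K).
  exists pred0, (fun _ _ => 0); split=> // [|q]; first by rewrite count_pred0 s0.
  by split=> [a b _ _|x y]; rewrite ?oppr0 // big1 // => m _; rewrite mul0r.
move eK : K s0 => K'; case: K' eK => [|[|d]] // eK s0.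
have ed : ~~ odd d by move: s0; rewrite /cusp_dim /= negbK; case: (odd d).
pose h := (d.-1 %/ 4)%N; pose t := (d %/ 6)%N; pose s := cusp_dim d.+2.
have ltd : (d < 6 * t + 6)%N by rewrite /t; lia.
have leh : (h <= d.-1 %/ 4)%N by [].
(* [L] imposes t linear conditions on h unknowns; this inequality leaves room for s independent
   solutions. *)
have les : (s + t <= h)%N.
  have dE : d = (2 * d./2)%N by rewrite mul2n even_halfK.
  move: s0; rewrite /s /t /h /cusp_dim /= negbK (negPf ed) dE; case: eqP => ?; lia.
pose L := cub_coefs d h t.
pose B := row_base (kermx L).
have lek : (s <= \rank (kermx L))%N by rewrite mxrank_ker; have := rank_leq_col L; lia.
have Bfull : row_full (B *m altmx d h)^T.
  by rewrite -col_leq_rank mxrank_tr mxrankMfree ?altmx_free // (eqP (row_base_free _)).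
(* [f] selects columns on which the solutions form an invertible minor; dividing by it yields [U],
   whose rows are unit vectors on these columns. *)
pose f := fullrankfun Bfull.
pose M := (rowsub f (B *m altmx d h)^T)^T.
have Mu : M \in unitmx by rewrite unitmx_tr fullrowsub_unit.
pose U := invmx M *m B.
have UJ i i' : (U *m altmx d h) i (f i') = (i == i')%:R.
  rewrite -mulmxA mxE; have <- : (invmx M *m M) i i' = (i == i')%:R by rewrite mulVmx // mxE.
  by rewrite mxE; apply: eq_bigr => j _; rewrite !mxE.
(* The solution space may be larger than s. Only the first s selected columns become pivots, which
   makes the count exact; [w q] has at most one summand and is 0 when q is not a pivot. *)
pose Z m := [exists i : 'I_(\rank (kermx L)), (i < s)%N && (Selt (f i) == m)].
pose w q := altw d (\sum_(i : 'I_(\rank (kermx L)) | (i < s)%N && (Selt (f i) == q)) row i U).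
exists Z, w; split=> [|q|q m /existsP[i' /andP[lti' /eqP <-]]].
- rewrite -size_filter -[RHS](size_enum_ord s).
  rewrite -(size_map (fun i => Selt (f (widen_ord lek i)))); apply: perm_size.
  have wf_inj : injective (fun i => Selt (f (widen_ord lek i))).
    move=> i j /Selt_inj /fullrankfun_inj /(congr1 val) /= ij; exact: val_inj.
  apply: uniq_perm => [||m]; first by rewrite filter_uniq ?Sset_uniq.
    by rewrite map_inj_uniq //; exact: enum_uniq.
  rewrite mem_filter; apply/andP/mapP => [[/existsP[i /andP[lti /eqP <-]] _]|[i _ ->]].
    by exists (Ordinal lti); rewrite ?mem_enum //; congr (Selt (f _)); apply: val_inj.
  split; last exact: Selt_mem.
  by apply/existsP; exists (widen_ord lek i); rewrite /= ltn_ord eqxx.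
- apply: Wc_altw => //; apply: (@cubsum_eq0 _ _ t) => //.
  rewrite mulmx_suml big1 // => i _; rewrite -row_mul -mulmxA.
  have -> : B *m L = 0 by apply/eqP; rewrite -sub_kermx eq_row_base.
  by rewrite mulmx0 row0.
rewrite /w -mul_altmx mulmx_suml summxE.
under eq_bigr do rewrite -row_mul mxE UJ.
have [<-|nq] := eqVneq (Selt (f i')) q.
  by rewrite (bigD1 i') ?lti' ?eqxx //= ?eqxx big1 ?addr0 // => i /andP[_ /negPf ->].
rewrite big1 // => i /andP[_ /eqP iq].
by case: eqP => // ii; rewrite -iq ii eqxx in nq.
Qed.

(** * Coefficients of the series O and S *)

Lemma ps_mul_X a g n : ps_mul (ps_X a) g n = if (a <= n)%N then g (n - a)%N else 0.
Proof.
rewrite /ps_mul /ps_X; case: leqP => [le|lt].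
  have lta : (a < n.+1)%N by [].
  rewrite (bigD1 (Ordinal lta)) //= eqxx mul1r big1 ?addr0 // => k nk.
  by case: eqP => [ka|_]; rewrite ?mul0r //; case/eqP: nk; apply: val_inj.
rewrite big1 // => k _; case: eqP => [ka|_]; rewrite ?mul0r //.
by have := ltn_ord k; lia.
Qed.

Lemma size_Sset1 K : size (Sset K 1) = odd_ge3 K.
Proof.
have [ok|nok] := boolP (odd_ge3 K).
  have /perm_size -> // : perm_eq (Sset K 1) [:: [:: K]].
  apply: uniq_perm; rewrite ?Sset_uniq // => m; rewrite mem_Sset inE.
  case: m => [|a [|b m]] //=; last by rewrite eqseq_cons andbF.
  by rewrite addn0 eqseq_cons !andbT; case: eqP => // ->; rewrite ok.
case E : (Sset K 1) => [//|m s]; have : m \in Sset K 1 by rewrite E inE eqxx.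
by rewrite mem_Sset; case: m {E} => [|a [|b m]] //=; rewrite addn0 andbT => /andP[/eqP->]; rewrite (negPf nok).
Qed.

Lemma OserE K : Oser K = (size (Sset K 1))%:R.
Proof.
rewrite /Oser ps_mul_X size_Sset1 /odd_ge3 /ps_geom andbC; case: leqP => //= leK.
by rewrite dvdn2 oddB //; case: (odd K).
Qed.

Lemma Oser2E K : ps_mul Oser Oser K = (size (Sset K 2))%:R.
Proof.
have sz (s : seq (seq nat)) : (size s)%:R = \sum_(m <- s) 1 :> rat.
  by rewrite -sum1_size natr_sum.
rewrite sz (@big_Sset_cat K 1 1) /ps_mul; apply: eq_bigr => k _.
by rewrite !OserE !sz mulr_suml; apply: eq_bigr => q _; rewrite mul1r.
Qed.

Lemma ps_geom46_add12 n :
  ps_mul (ps_geom 4) (ps_geom 6) (n + 12)%N =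
  ps_mul (ps_geom 4) (ps_geom 6) n + (~~ odd n)%:R.
Proof.
rewrite /ps_mul -addSn big_split_ord /=; congr (_ + _).
  apply: eq_bigr => k _; have ltk := ltn_ord k; rewrite /ps_geom.
  by rewrite addnC -addnBA // dvdn_addr.
rewrite /ps_geom !big_ord_recl big_ord0 /= /bump /=.
(* Among the twelve additional indices only n + 6 and n + 12 leave a multiple of 6; one of them is
   divisible by 4 if n is even, and none if n is odd. *)
have e (k : nat) : (k < 12)%N -> (n + 12 - (n.+1 + k) = 11 - k)%N by lia.
rewrite !e //= !mulr0 !mulr1 !add0r !addr0.
have [on|en] := boolP (odd n).
  have -> : (4 %| n.+1 + 5)%N = false by apply/negbTE; lia.
  have -> : (4 %| n.+1 + 11)%N = false by apply/negbTE; lia.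
  by [].
have [d|d] := boolP (4 %| n)%N.
  have -> : (4 %| n.+1 + 5)%N = false by apply/negbTE; lia.
  have -> : (4 %| n.+1 + 11)%N by lia.
  by [].
have -> : (4 %| n.+1 + 5)%N by lia.
have -> : (4 %| n.+1 + 11)%N = false by apply/negbTE; lia.
by [].
Qed.

Lemma SserE K : Sser K = (cusp_dim K)%:R.
Proof.
have nSlt n : (n < 12)%N -> cusp_dim n = 0%N by move: n; do 12?[case=> //].
(* n = 2 is exceptional because of the truncation: the values at 2 and at 14 are both 0. *)
have nS_add n : cusp_dim (n + 12) = (if n == 2%N then 0%N else cusp_dim n + ~~ odd n)%N.
  rewrite /cusp_dim oddD addbF; case: (boolP (odd n)) => on; first by case: (n =P 2%N).
  case: (n =P 2%N) => [->|n2] //; rewrite divnDr // modnDr.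
  by case: eqP => ?; lia.
rewrite /Sser ps_mul_X; case: (leqP 12 K) => [le|lt]; last by rewrite (nSlt _ lt).
rewrite -{2}(subnK le); move: (K - 12)%N => {le}n.
have base k : (k < 12)%N -> ps_mul (ps_geom 4) (ps_geom 6) k = (cusp_dim (k + 12))%:R.
  move=> ltk; rewrite nS_add nSlt // /ps_mul /ps_geom.
  do 12?[case: k ltk => [_|k ltk]; first by rewrite !big_ord_recl big_ord0 /=; lra].
  by [].
elim/ltn_ind: n => n IH; have [ltn|len] := ltnP n 12; first exact: base.
rewrite -(subnK len) ps_geom46_add12 IH; last lia.
rewrite !nS_add; do 2?case: eqP => ?; try lia.
all: by rewrite !natrD oddD addbF.
Qed.

(** * The kernel in depth 4 *)

Lemma Wc_scale K c w g : Wc K w -> (forall a b, g [:: a; b] = c * w [:: a; b]) -> Wc K g.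
Proof.
move=> [wa w0] gw; split=> [a b oka okb|x y]; first by rewrite !gw wa // mulrN.
rewrite -[RHS](mulr0 c) -[X in _ = _ * X](w0 x y) mulr_sumr big_seq [RHS]big_seq.
by apply: eq_bigr => q /Sset2[a [b [-> _ _]]]; rewrite gw mulrA.
Qed.

Lemma wcond_sum n (c : 'I_n -> rat) (f : 'I_n -> seq nat -> rat) :
  (forall i, wcond (f i)) -> wcond (fun m => \sum_i c i * f i m).
Proof.
move=> fW K t; split=> [a b oka okb|x y].
  by rewrite /= -sumrN; apply: eq_bigr => i _; rewrite (wcond_anti _ (fW i) oka okb) mulrN.
under eq_bigr do rewrite mulr_suml.
rewrite exchange_big big1 //= => i _.
rewrite -[RHS](mulr0 (c i)) -[X in _ = _ * X]((fW i K t).2 x y) mulr_sumr.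
by apply: eq_bigr => q _; rewrite mulrA.
Qed.

(** * Projections along the chosen period polynomials *)

Definition pivots_at (K : nat) : pred (seq nat) := projT1 (period_pivots K).
Definition relations_at (K : nat) : seq nat -> seq nat -> rat := sval (projT2 (period_pivots K)).

Definition pivot (m : seq nat) : bool := pivots_at (sumn m) m.
(** The period relation holds for [relations_at K] in weight K only, hence the cut-off outside the
    weight of q. *)
Definition relation (q m : seq nat) : rat := if sumn m == sumn q then relations_at (sumn q) q m else 0.
Definition reduct (q m : seq nat) : rat := (q == m)%:R - relation q m.

Lemma count_pivot K : count pivot (Sset K 2) = cusp_dim K.
Proof.
rewrite /pivot; have [cZ _ _] := svalP (projT2 (period_pivots K)); rewrite -[RHS]cZ.
by apply: eq_in_count => m /sumn_Sset ->.
Qed.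

Lemma Wc_relation K q : Wc K (relation q).
Proof.
have [_ W _] := svalP (projT2 (period_pivots (sumn q))).
split=> [a b oka okb|x y].
  rewrite /relation /= !addn0 addnC; case: ifP => _; last by rewrite oppr0.
  exact: (W q).1.
have [Kq|nK] := eqVneq K (sumn q); last first.
  by rewrite big1_seq // => m /= /sumn_Sset mK; rewrite /relation mK (negPf nK) mul0r.
rewrite -[RHS]((W q).2 x y) -Kq big_seq [RHS]big_seq.
by apply: eq_bigr => m /sumn_Sset mK; rewrite /relation mK -Kq eqxx.
Qed.

Lemma reduct_pivot q m : pivot m -> reduct q m = 0.
Proof.
move=> Zm; rewrite /reduct /relation; have [_ _ W] := svalP (projT2 (period_pivots (sumn q))).
case: (sumn m =P sumn q) => [mq|nmq].
  by rewrite /relations_at W ?subrr //; move: Zm; rewrite /pivot /pivots_at mq.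
by case: (q =P m) => [qm|]; rewrite ?subrr // qm in nmq.
Qed.

Definition mid (m : seq nat) := take 2 (behead m).

Definition phi1 (m n : seq nat) : rat := relation (take 2 m) (take 2 n) * (drop 2 m == drop 2 n)%:R.
Definition phi2 (m n : seq nat) : rat :=
  reduct (take 2 m) (take 2 n) * relation (drop 2 m) (take 2 (drop 2 n)).
Definition psi (m n : seq nat) : rat :=
  (take 1 m == take 1 n)%:R * relation (mid m) (mid n) * (drop 3 m == drop 3 n)%:R.

Lemma wcond_phi1 m : wcond (phi1 m).
Proof.
move=> K t; apply: (@Wc_scale K ((drop 2 m == t)%:R) (relation (take 2 m))) => [|a b].
  exact: Wc_relation.
by rewrite /phi1 /= take0 drop0 mulrC.
Qed.

Lemma wlast_phi2 m : wlast (phi2 m).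
Proof.
move=> a b K t.
apply: (@Wc_scale K (reduct (take 2 m) [:: a; b]) (relation (drop 2 m))) => [|a' b'].
  exact: Wc_relation.
by rewrite /phi2 /= !take0.
Qed.

Lemma wmid_psi m : wmid (psi m).
Proof.
move=> a K t.
apply: (@Wc_scale K ((take 1 m == [:: a])%:R * (drop 3 m == t)%:R) (relation (mid m))) => [|a' b'].
  exact: Wc_relation.
by rewrite /psi /mid /= ?take0 ?drop0; ring.
Qed.

Lemma Sset4 N m : m \in Sset N 4 -> exists a b a' b', m = [:: a; b; a'; b'].
Proof.
move=> /size_Sset; case: m => [|a [|b [|a' [|b' [|]]]]] // _.
by exists a, b, a', b'.
Qed.

(* 1 - c (x) c = (1 - c) (x) 1 + c (x) (1 - c), where c is [reduct], the projection along W
   that kills the pivots. *)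
Lemma phi_pivot N m n : m \in Sset N 4 -> n \in Sset N 4 ->
  pivot (take 2 n) || pivot (drop 2 n) -> phi1 m n + phi2 m n = (m == n)%:R.
Proof.
move=> mS nS' Zn.
have cc : reduct (take 2 m) (take 2 n) * reduct (drop 2 m) (drop 2 n) = 0.
  by case/orP: Zn => /reduct_pivot ->; rewrite ?mulr0 ?mul0r.
rewrite -[RHS]subr0 -[X in _ = _ - X]cc /phi1 /phi2.
have [a [b [a' [b' ->]]]] := Sset4 mS; have [u [v [u' [v' ->]]]] := Sset4 nS'.
rewrite /= /reduct.
have -> : ([:: a; b; a'; b'] == [:: u; v; u'; v'])%:R =
    ([:: a; b] == [:: u; v])%:R * ([:: a'; b'] == [:: u'; v'])%:R :> rat.
  by rewrite -natrM mulnb !eqseq_cons !andbT -!andbA.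
by ring.
Qed.

Lemma psi_pivot N m n : m \in Sset N 4 -> n \in Sset N 4 ->
  pivot (mid n) -> psi m n = (m == n)%:R.
Proof.
move=> mS nS' Zn; have /eqP := reduct_pivot (mid m) Zn; rewrite subr_eq0 eq_sym => /eqP; rewrite /psi => ->.
have [a [b [a' [b' ->]]]] := Sset4 mS; have [u [v [u' [v' ->]]]] := Sset4 nS'.
rewrite /= -!natrM !mulnb; congr (_%:R); congr nat_of_bool.
by rewrite !eqseq_cons !andbT -!andbA.
Qed.

Lemma mul_mkmx N r n (x : 'rV_n) (f : 'I_n -> seq nat -> rat) :
  x *m (\matrix_(i, j) f i (Selt j)) = mkrow N r (fun m => \sum_i x 0 i * f i m).
Proof. by apply/rowP => j; rewrite !mxE; apply: eq_bigr => i _; rewrite mxE. Qed.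

Lemma mkrow_Cmx N f :
  mkrow N 4 f *m Cmx N 4 = mkrow N 4 (actE 4 4 (actE 4 3 (actE 4 2 f))).
Proof. by rewrite /Cmx /= mulmx1 !mulmxA !mkrow_mulE. Qed.

Lemma actE_eq0 N r j f n : {in Sset N r, f =1 fun=> 0} -> sumn n = N -> actE r j f n = 0.
Proof. by move=> f0 nN; rewrite (@actE_ext _ _ _ (fun=> 0)) ?actE0 // nN. Qed.

Lemma sum_kernel N f1 f2 n : wcond f1 -> wlast f2 -> n \in Sset N 4 ->
  actE 4 4 (actE 4 3 (actE 4 2 (fun m => f1 m + f2 m))) n = 0.
Proof.
move=> W1 W2 nS'; rewrite (@actE_ext _ _ _ (actE 4 3 (actE 4 2 f1))) => [|m mS].
  by apply: wcond_actE3 nS'; exact: wcond_actE.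
apply: actE_ext => k kS; rewrite actED (wlast_actE W2 kS) addr0 //.
Qed.

Lemma mid_kernel N f n : wmid f -> n \in Sset N 4 -> actE 4 4 (actE 4 3 (actE 4 2 f)) n = 0.
Proof.
by move=> W nS'; apply: (@actE_eq0 N) (sumn_Sset nS') => m mS; exact: wmid_actE W mS.
Qed.

(** E^(2) kills f2, so g and f1 have the same image under E^(2), and E^(3) kills it because g lies
    in W23. That image still satisfies the relation in the first two variables, so (H) in depth 4
    makes it 0. Then g is killed by E^(2), and (H) in depth 3, applied for each first index, gives g
    = 0. *)
Lemma mid_sum_disjoint N f1 f2 g : hypH -> wcond f1 -> wlast f2 -> wmid g ->
  {in Sset N 4, forall m, g m = f1 m + f2 m} -> {in Sset N 4, g =1 fun=> 0}.
Proof.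
move=> H W1 W2 Wg gE.
have op2E : {in Sset N 4, actE 4 2 g =1 actE 4 2 f1}.
  move=> m mS; rewrite (@actE_ext _ _ _ (fun m => f1 m + f2 m)) ?(sumn_Sset mS) //.
  by rewrite actED (wlast_actE W2 mS) addr0.
have f1_0 : {in Sset N 4, actE 4 2 f1 =1 fun=> 0}.
  apply: (actE_wcond_inj H (wcond_actE W1)) => m mS.
  rewrite -(wmid_actE Wg mS); apply: actE_ext => k; rewrite (sumn_Sset mS) => kS.
  by rewrite op2E.
move=> m /SsetS[a [t [-> oka leaN tS]]].
apply: (actE_wcond_inj H (Wg a) _ tS) => s sS.
have asS : a :: s \in Sset N 4.
  move: sS; rewrite !mem_Sset => /and3P[/eqP szs /eqP ss oks].
  by rewrite /= szs ss oka oks subnKC // !eqxx.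
by rewrite -[RHS](f1_0 _ asS) -op2E // actE_cons.
Qed.

Definition Phi N : 'M[rat]_(Sidx N 4) :=
  \matrix_(i, j) (phi1 (Selt i) (Selt j) + phi2 (Selt i) (Selt j)).
Definition Psi N : 'M[rat]_(Sidx N 4) := \matrix_(i, j) psi (Selt i) (Selt j).

Lemma mul_Phi N (x : 'rV_(Sidx N 4)) : exists f1 f2,
  [/\ wcond f1, wlast f2 & x *m Phi N = mkrow N 4 (fun m => f1 m + f2 m)].
Proof.
exists (fun m => \sum_i x 0 i * phi1 (Selt i) m), (fun m => \sum_i x 0 i * phi2 (Selt i) m).
split.
- by apply: wcond_sum => i; exact: wcond_phi1.
- by move=> a b; apply: wcond_sum => i; exact: wlast_phi2.
apply/rowP => j; rewrite !mxE -big_split; apply: eq_bigr => i _.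
by rewrite mxE mulrDr.
Qed.

Lemma mul_Psi N (x : 'rV_(Sidx N 4)) : exists2 g, wmid g & x *m Psi N = mkrow N 4 g.
Proof.
exists (fun m => \sum_i x 0 i * psi (Selt i) m); last exact: mul_mkmx.
by move=> a; apply: wcond_sum => i; exact: wmid_psi.
Qed.

(** For a square matrix the left and right kernels have the same dimension, so the left-kernel
    vectors found above can be counted. *)
Lemma dimkerE n (A : 'M[rat]_n) : dimker A = \rank (kermx A).
Proof. by rewrite /dimker !mxrank_ker mxrank_tr. Qed.

Lemma rank_Phi_Psi N : hypH -> (\rank (Phi N) + \rank (Psi N) <= dimker (Cmx N 4))%N.
Proof.
move=> H; have cap0 : (Phi N :&: Psi N = 0)%MS.
  apply/eqP; rewrite -submx0; apply/rV_subP => v.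
  rewrite sub_capmx => /andP[/submxP[x ->] /submxP[y]].
  have [f1 [f2 [W1 W2 ->]]] := mul_Phi x; have [g Wg ->] := mul_Psi y.
  move=> /mkrowP fg; rewrite submx0; apply/eqP.
  have g0 := mid_sum_disjoint H W1 W2 Wg (fun m mS => esym (fg m mS)).
  by apply/rowP => i; rewrite !mxE (fg _ (Selt_mem i)) g0 ?Selt_mem.
rewrite dimkerE -mxrank_disjoint_sum // mxrankS // addsmx_sub.
apply/andP; split; apply/rV_subP => v /submxP[x ->]; apply/sub_kermxP.
  have [f1 [f2 [W1 W2 ->]]] := mul_Phi x; rewrite mkrow_Cmx.
  by apply/rowP => i; rewrite !mxE (sum_kernel W1 W2 (Selt_mem i)).
have [g Wg ->] := mul_Psi x; rewrite mkrow_Cmx.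
by apply/rowP => i; rewrite !mxE (mid_kernel Wg (Selt_mem i)).
Qed.

(** * Counting the pivot columns *)

Lemma card_Selt N r (P : pred (seq nat)) :
  (#|[pred i : 'I_(Sidx N r) | P (Selt i)]|)%:R = \sum_(m <- Sset N r) (P m)%:R :> rat.
Proof.
rewrite -sum_Selt -sum1_card natr_sum big_mkcond; apply: eq_bigr => i _.
by rewrite inE; case: (P _).
Qed.

Lemma sum_pivot K : \sum_(q <- Sset K 2) (pivot q)%:R = Sser K.
Proof.
rewrite SserE -count_pivot -sum1_count natr_sum [RHS]big_mkcond.
by apply: eq_bigr => q _; case: (pivot q).
Qed.

Lemma sum_Sset2_const K (x : rat) : \sum_(q <- Sset K 2) x = ps_mul Oser Oser K * x.
Proof. by rewrite Oser2E -sum1_size natr_sum mulr_suml; apply: eq_bigr => q _; rewrite mul1r. Qed.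

Lemma ps_mulC a b n : ps_mul a b n = ps_mul b a n.
Proof.
rewrite /ps_mul (reindex_inj rev_ord_inj); apply: eq_bigr => k _ /=.
have le : (k <= n)%N by rewrite -ltnS ltn_ord.
by rewrite mulrC subSS subKn.
Qed.

Lemma sum_pivot_head N : \sum_(m <- Sset N 4) (pivot (take 2 m))%:R =
  ps_mul (ps_mul Oser Oser) Sser N.
Proof.
rewrite ps_mulC (@big_Sset_cat N 2 2); apply: eq_bigr => K _.
rewrite -sum_pivot mulr_suml big_seq [RHS]big_seq; apply: eq_bigr => q qS.
under eq_bigr do rewrite take_size_cat ?(size_Sset qS) //.
by rewrite sum_Sset2_const mulrC.
Qed.

Lemma sum_pivot_mid N : \sum_(m <- Sset N 4) (pivot (mid m))%:R =
  ps_mul (ps_mul Oser Oser) Sser N.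
Proof.
rewrite -sum_pivot_head.
(* A permutation of the entries that moves the middle pair to the front. *)
pose g (m : seq nat) := if m is [:: a; b; a'; b'] then [:: b; a'; a; b'] else m.
rewrite -[RHS](@big_Sset_reindex N 4 g) => [|m mS|m n mS nS'].
- rewrite big_seq [RHS]big_seq; apply: eq_bigr => m /Sset4[a [b [a' [b' ->]]]].
  by [].
- have [a [b [a' [b' mE]]]] := Sset4 mS; move: mS; rewrite mE !mem_Sset /=.
  move=> /andP[/eqP <- /and5P[-> -> -> -> _]]; rewrite !andbT; apply/eqP; lia.
have [a [b [a' [b' ->]]]] := Sset4 mS; have [u [v [u' [v' ->]]]] := Sset4 nS'.
by move=> /= [-> -> -> ->].
Qed.

(** Inclusion-exclusion: S^2 counts the indices both of whose pairs are pivots. *)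
Lemma sum_pivot_head_last N :
  \sum_(m <- Sset N 4) (pivot (take 2 m) || pivot (drop 2 m))%:R =
  2 * ps_mul (ps_mul Oser Oser) Sser N - ps_mul Sser Sser N.
Proof.
have -> : 2 * ps_mul (ps_mul Oser Oser) Sser N =
    ps_mul Sser (ps_mul Oser Oser) N + ps_mul (ps_mul Oser Oser) Sser N.
  by rewrite [ps_mul Sser _ _]ps_mulC; ring.
rewrite (@big_Sset_cat N 2 2) -big_split -sumrB; apply: eq_bigr => K _ /=.
rewrite -!sum_pivot mulr_suml -sum_Sset2_const mulr_suml -big_split -sumrB /=.
rewrite big_seq [RHS]big_seq; apply: eq_bigr => q qS.
rewrite mulrC -sum_Sset2_const mulr_sumr -big_split -sumrB /=; apply: eq_bigr => t _.
rewrite take_size_cat ?drop_size_cat ?(size_Sset qS) //.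
by case: (pivot q); case: (pivot t); rewrite /=; ring.
Qed.

Theorem theorem1p2 :
  hypH ->
  forall N : nat, (0 < N)%N ->
    3 * ps_mul (ps_mul Oser Oser) Sser N - ps_mul Sser Sser N
      <= ((dimker (Cmx N 4))%:R : rat).
Proof.
move=> H N _; pose P1 (m : seq nat) := pivot (take 2 m) || pivot (drop 2 m).
have r1 : (#|[pred i : 'I_(Sidx N 4) | P1 (Selt i)]| <= \rank (Phi N))%N.
  apply: rank_pivots => i j Pj; rewrite mxE (phi_pivot (Selt_mem i) (Selt_mem j)) //.
  by rewrite (inj_eq (@Selt_inj _ _)).
have r2 : (#|[pred i : 'I_(Sidx N 4) | pivot (mid (Selt i))]| <= \rank (Psi N))%N.
  apply: rank_pivots => i j Pj; rewrite mxE (psi_pivot (Selt_mem i) (Selt_mem j)) //.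
  by rewrite (inj_eq (@Selt_inj _ _)).
have : (#|[pred i : 'I_(Sidx N 4) | P1 (Selt i)]| +
        #|[pred i : 'I_(Sidx N 4) | pivot (mid (Selt i))]| <= dimker (Cmx N 4))%N.
  exact: leq_trans (leq_add r1 r2) (rank_Phi_Psi N H).
rewrite -(ler_nat rat) natrD (card_Selt N 4 P1) (card_Selt N 4 (fun m => pivot (mid m))).
by rewrite sum_pivot_head_last sum_pivot_mid; lra.
Qed.
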